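(* Let $f\colon X\to Y$ be a continuous map between locally compact Hausdorff spaces. If $(Z,g)$ is a fibrewise compactification of $f$, then $(C_0(Z),g^* )$ is a (noncommutative) fibrewise compactification of $f^*\in\operatorname{Mor}(C_0(Y),C_0(X))$. Conversely, if $(C,\psi)$ is a (noncommutative) fibrewise compactification of $f^*$, then $C$ is commutative and $(\widehat{C},\psi_* )$ is a fibrewise compactification of $f$. The same is true when restricting to perfections (in both the topological and the noncommutative sense).
   Context: Topological side. A subset is precompact if its closure is compact; a map is proper if preimages of compact sets are compact. For continuous $f\colon X\to Y$ between locally compact Hausdorff spaces, $\operatorname{Prp}(f)$ is the union of all precompact open $W\subseteq Y$ such that $f^{-1}(\overline{W})$ is compact. A fibrewise compactification of $f$ is a pair $(Z,g)$ of a locally compact Hausdorff space $Z$ and a continuous proper map $g\colon Z\to Y$ such that (F1) there is an open inclusion $\iota_X\colon X\to Z$ with $g\circ\iota_X=f$; and (F2) the restriction of $g$ to $Z\setminus\overline{\iota_X(X)}$ is a homeomorphism onto a subset of $\operatorname{Prp}(f)$ that is closed in the subspace topology of $\operatorname{Prp}(f)$. It is a perfection if $g$ is also surjective. $C^*$-side. Ideals are norm-closed and two-sided; $\mathcal{M}(B)$ is the multiplier algebra of $B$. $\operatorname{Mor}(A,B)$ is the set of $*$-homomorphisms $\varphi\colon A\to\mathcal{M}(B)$ with $\operatorname{span}\varphi(A)B$ norm dense in $B$; $\operatorname{Mor_p}(A,B)$ (proper morphisms) is the set of those with $\varphi(A)\subseteq B$, equivalently $*$-homomorphisms $A\to B$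 with $\varphi(A)B$ densely spanning $B$. For $\varphi\in\operatorname{Mor}(A,B)$, $\operatorname{Pim}(\varphi):=\varphi^{-1}(B)$. If $B$ is an ideal of $C$, the induced morphism $\alpha_C\in\operatorname{Mor}(C,B)$ is the map $C\to\mathcal{M}(B)$, $\alpha_C(c)b=cb$, and $B^\perp=\{c\in C: cb=0\ \forall b\in B\}$. A (noncommutative) fibrewise compactification of $\varphi\in\operatorname{Mor}(A,B)$ is a pair $(C,\psi)$ of a $C^*$-algebra $C$ and $\psi\in\operatorname{Mor_p}(A,C)$ such that (NF1) $B$ is isomorphic to an ideal of $C$ and the induced morphism $\alpha_C\in\operatorname{Mor}(C,B)$ satisfies $\alpha_C\circ\psi=\varphi$; and (NF2) the image of the $*$-homomorphism $\overline{\psi}\colon\operatorname{Pim}(\varphi)\to C/B$, $\overline{\psi}(a)=\psi(a)+B$, contains $\{c+B: c\in B^\perp\}$. It is a (noncommutative) perfection if $\psi$ is injective. For continuous $f\colon X\to Y$, $f^*\colon C_0(Y)\to C_b(X)\cong\mathcal{M}(C_0(X))$ is $f^*(a)=a\circ f$, which lies in $\operatorname{Mor}(C_0(Y),C_0(X))$; for proper continuous $g\colon Z\to Y$, $g^*\in\operatorname{Mor_p}(C_0(Y),C_0(Z))$. For a commutative $C^*$-algebra $C$, $\widehat{C}$ is its spectrum, and for $\psi\in\operatorname{Mor_p}(C_0(Y),C)$, $\psi_*\colon\widehat{C}\to Y$ is the Gelfand-dual continuous map, with $(\psi_* )^*=\psi$ (identifying $Y$ with the spectrum of $C_0(Y)$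 and $C$ with $C_0(\widehat C)$). *)

(* Defs.v *)
From HB Require Import structures.
From mathcomp Require Import all_boot all_order all_algebra.
From mathcomp Require Import complex.
From mathcomp Require Import all_classical all_reals all_analysis.

Set Implicit Arguments.
Unset Strict Implicit.
Unset Printing Implicit Defensive.

Import Order.TTheory GRing.Theory Num.Theory.
Import numFieldNormedType.Exports.

Local Open Scope classical_set_scope.
Local Open Scope ring_scope.

(* Algebras need not be unital, hence are not [algType]s. *)
HB.mixin Record Lmodule_isStarAlg (R : realType) A & GRing.Lmodule R[i] A := {
  amul : A -> A -> A;
  star : A -> A;
  amulA : associative amul;
  amulDl : left_distributive amul +%R;
  amulDr : right_distributive amul +%R;
  amulZl : forall (k : R[i]) (x y : A), amul (k *: x) y = k *: amul x y;
  amulZr : forall (k : R[i]) (x y : A), amul x (k *: y) = k *: amul x y;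
  starK : involutive star;
  starD : {morph star : x y / x + y};
  starZ : forall (k : R[i]) (x : A), star (k *: x) = Num.conj k *: star x;
  starM : forall x y : A, star (amul x y) = amul (star y) (star x)
}.

#[short(type="starAlgType")]
HB.structure Definition StarAlg (R : realType) :=
  {A of GRing.Lmodule R[i] A & Lmodule_isStarAlg R A}.

Notation "x ** y" := (amul x y) (at level 40, left associativity) : ring_scope.

HB.mixin Record StarAlg_isCstar (R : realType) A
    & StarAlg R A & CompleteNormedModule R[i] A := {
  norm_amul_le : forall x y : A, `|x ** y| <= `|x| * `|y|;
  cstar_identity : forall x : A, `|star x ** x| = `|x| ^+ 2
}.

#[short(type="cstarType")]
HB.structure Definition Cstar (R : realType) :=
  {A of StarAlg R A & CompleteNormedModule R[i] A & StarAlg_isCstar R A}.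

Section complex_complete.
Variable R : realType.
Implicit Types z : R[i].

Lemma Re_norm z : (complex.Re `|z|)%:C%C = `|z|.
Proof. by case: z. Qed.

Lemma ler_Re_norm z : `|complex.Re z|%:C%C <= `|z|.
Proof.
case: z => a b /=; rewrite normc_def /= lecR -sqrtr_sqr ler_wsqrtr //.
by rewrite lerDl sqr_ge0.
Qed.

Lemma ler_Im_norm z : `|complex.Im z|%:C%C <= `|z|.
Proof.
case: z => a b /=; rewrite normc_def /= lecR -sqrtr_sqr ler_wsqrtr //.
by rewrite lerDr sqr_ge0.
Qed.

Lemma ler_norm_ReIm z :
  `|z| <= (`|complex.Re z| + `|complex.Im z|)%:C%C.
Proof.
case: z => a b /=; rewrite normc_def /= lecR.
rewrite -[leRHS]ger0_norm ?addr_ge0 // -sqrtr_sqr ler_wsqrtr //.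
rewrite sqrrD !real_normK ?num_real // -addrA lerD2l lerDr.
by rewrite mulrn_wge0 // mulr_ge0.
Qed.

Lemma complex_cauchy_cvg (F : set_system R[i]^o) :
  ProperFilter F -> cauchy F -> cvg F.
Proof.
move=> FF /cauchy_ballP Fc.
have cRe : cvg ((fun z : R[i] => complex.Re z) @ F).
  apply: cauchy_cvg; apply/cauchy_ballP => e e0.
  have : (0 : R[i]) < e%:C%C by rewrite ltcR.
  move=> /Fc [[A B] /= [FA FB] AB].
  exists ([set complex.Re z | z in A], [set complex.Re z | z in B]).
    by split; [apply: filterS FA|apply: filterS FB] => z Hz /=; exists z.
  move=> [_ _] [[x Ax <-] [y By <-]] /=.
  have := AB (x, y) (conj Ax By); rewrite -!ball_normE /= => xy.
  by rewrite -ltcR (le_lt_trans _ xy) // -raddfB ler_Re_norm.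
have cIm : cvg ((fun z : R[i] => complex.Im z) @ F).
  apply: cauchy_cvg; apply/cauchy_ballP => e e0.
  have : (0 : R[i]) < e%:C%C by rewrite ltcR.
  move=> /Fc [[A B] /= [FA FB] AB].
  exists ([set complex.Im z | z in A], [set complex.Im z | z in B]).
    by split; [apply: filterS FA|apply: filterS FB] => z Hz /=; exists z.
  move=> [_ _] [[x Ax <-] [y By <-]] /=.
  have := AB (x, y) (conj Ax By); rewrite -!ball_normE /= => xy.
  by rewrite -ltcR (le_lt_trans _ xy) // -raddfB ler_Im_norm.
move: cRe cIm => /cvg_ex[/= a Fa] /cvg_ex[/= b Fb].
apply/cvg_ex; exists ((a +i* b)%C : R[i]^o).
apply/(@cvgrPdist_lt R[i] R[i]^o) => e.
case: e => e e'; rewrite ltcE /= => /andP[/eqP -> e0].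
have e20 : 0 < e / 2 by rewrite divr_gt0.
move/cvgrPdist_lt : Fa => /(_ _ e20) Fa.
move/cvgrPdist_lt : Fb => /(_ _ e20) Fb.
near=> z.
apply: (le_lt_trans (ler_norm_ReIm _)).
rewrite (_ : (e +i* 0)%C = e%:C%C) // ltcR.
rewrite !raddfB /= (splitr e) ltrD //.
  by near: z.
by near: z.
Unshelve. all: by end_near. Qed.

HB.instance Definition _ := Uniform_isComplete.Build R[i]^o complex_cauchy_cvg.

End complex_complete.

Section C0_space.
Variables (R : realType) (X : topologicalType).
Local Notation C := (R[i]^o).
Implicit Types f g : X -> C.

Definition vanishing f :=
  forall e : R[i], 0 < e -> compact [set x | e <= `|f x|].

Lemma closed_le_norm f (e : R[i]) : continuous f -> 0 < e ->
  closed [set x | e <= `|f x|].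
Proof.
move=> cf e0; rewrite (_ : mkset _ = ~` (f @^-1` ball (0 : C) e)).
  apply: open_closedC; move/continuousP : cf; apply; exact: ball_open.
rewrite -ball_normE; apply/seteqP; split=> x /=; rewrite sub0r normrN.
  by move=> /le_gtF ->.
move=> /negP; rewrite -real_leNgt //; exact: gtr0_real.
Qed.

Lemma le_norm_split (z w e : R[i]) : 0 < e -> e <= `|z + w| ->
  e / 2 <= `|z| \/ e / 2 <= `|w|.
Proof.
move=> e0 le_e; have e2r : e / 2 \is Num.real by rewrite gtr0_real ?divr_gt0.
have [|z_lt] := real_leP e2r (normr_real z); [by left|].
have [|w_lt] := real_leP e2r (normr_real w); [by right|].
suff : `|z + w| < e by move=> /(le_lt_trans le_e); rewrite ltxx.
by rewrite (le_lt_trans (ler_normD _ _)) // (splitr e) ltrD.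
Qed.

Lemma vanishing0 : vanishing (fun=> 0).
Proof.
move=> e e0; rewrite (_ : mkset _ = set0); first exact: compact0.
by apply/seteqP; split=> x //=; rewrite normr0 => /(lt_le_trans e0); rewrite ltxx.
Qed.

Lemma vanishing_le f g (k : R[i]) : continuous g -> 0 < k ->
  (forall x, `|g x| <= k * `|f x|) -> vanishing f -> vanishing g.
Proof.
move=> cg k0 gf vf e e0.
apply: (subclosed_compact (closed_le_norm cg e0) (vf (k^-1 * e) _)).
  by rewrite mulr_gt0 ?invr_gt0.
by move=> x /= le_e; rewrite ler_pdivrMl // (le_trans le_e).
Qed.

Lemma continuousD_C f g : continuous f -> continuous g ->
  continuous (fun x => f x + g x : C).
Proof. by move=> cf cg x; exact: (cvgD (cf x) (cg x)). Qed.

Lemma vanishingD f g : continuous f -> continuous g ->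
  vanishing f -> vanishing g -> vanishing (fun x => f x + g x).
Proof.
move=> cf cg vf vg e e0.
have e20 : 0 < e / 2 by rewrite divr_gt0.
apply: (subclosed_compact _ (compactU (vf _ e20) (vg _ e20))).
  exact: (closed_le_norm (continuousD_C cf cg) e0).
by move=> x /= /(le_norm_split e0).
Qed.

Lemma continuousM_C f g : continuous f -> continuous g ->
  continuous (fun x => f x * g x : C).
Proof.
move=> cf cg x; exact: (@cvgM R[i] _ _ _ f g _ _ (cf x) (cg x)).
Qed.

Lemma continuousJ_C f : continuous f -> continuous (fun x => Num.conj (f x) : C).
Proof.
move=> cf x; apply/(@cvgrPdist_lt R[i] C) => e e0.
move/(@cvgrPdist_lt R[i] C) : (cf x) => /(_ _ e0).
by apply: filterS => y /=; rewrite -rmorphB norm_conjC.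
Qed.

Lemma vanishing_bounded f : continuous f -> vanishing f ->
  exists M : R, forall x, complex.Re `|f x| <= M.
Proof.
move=> cf vf; pose n x : R := complex.Re `|f x|.
have cn : continuous n.
  move=> x; apply/cvgrPdist_lt => e e0.
  have eC : (0 : R[i]) < e%:C%C by rewrite ltcR.
  move/(@cvgrPdist_lt R[i] C) : (cf x) => /(_ _ eC).
  apply: filterS => y fxy; rewrite -ltcR (le_lt_trans _ fxy) //.
  rewrite /n -raddfB (le_trans (ler_Re_norm _)) //; exact: ler_dist_dist.
pose K := [set x | (1 : R[i]) <= `|f x|].
have cK : compact [set n x | x in K].
  apply: continuous_compact; last exact: vf.
  exact: continuous_subspaceT.
have [M [_ HM]] := compact_bounded cK.
exists (Num.max 1 (M + 1)) => x.
have [x1|x1] := real_leP (real1 _) (normr_real (f x)).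
  rewrite le_max; apply/orP; right.
  rewrite (le_trans (ler_norm _)) //; apply: HM; first by rewrite ltrDl.
  by exists x.
by rewrite le_max -lecR Re_norm (ltW x1).
Qed.

Definition C0_pred : {pred X -> C} :=
  mem [set f | continuous f /\ vanishing f].

Record C0 := MkC0 { C0_fun :> X -> C ; _ : C0_fun \in C0_pred }.

HB.instance Definition _ := [isSub for C0_fun].
HB.instance Definition _ := gen_eqMixin C0.
HB.instance Definition _ := gen_choiceMixin C0.

Lemma C0_submod_closed : submod_closed C0_pred.
Proof.
split; first by rewrite inE; split; [exact: cst_continuous|exact: vanishing0].
move=> k f g; rewrite !inE => -[cf vf] [cg vg].
have ck : continuous (k *: f).
  exact: (continuousM_C (@cst_continuous X C k) cf).
split; first exact: continuousD_C.
apply: vanishingD => //.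
have k0 : 0 < `|k| + 1 by rewrite ltr_wpDl.
apply: (vanishing_le ck k0 _ vf) => x.
by rewrite [_ x]/(k * f x) normrM ler_wpM2r // lerDl.
Qed.

HB.instance Definition _ :=
  GRing.isSubmodClosed.Build R[i] (X -> C) C0_pred C0_submod_closed.
HB.instance Definition _ := [SubChoice_isSubLmodule of C0 by <:].

End C0_space.

Section C0_norm.
Variables (R : realType) (X : topologicalType).
Local Notation C := (R[i]^o).
Local Notation T := (C0 R X).
Implicit Types f g : T.

Lemma C0_continuous f : continuous f.
Proof. by case: f => f /= /set_mem[]. Qed.

Lemma C0_vanishing f : vanishing f.
Proof. by case: f => f /= /set_mem[]. Qed.

Lemma C0_eqP f g : (forall x, f x = g x) -> f = g.
Proof. by move=> fg; apply: val_inj; apply/funext. Qed.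

Definition mkC0 (f : X -> C) (cf : continuous f) (vf : vanishing f) : T :=
  MkC0 (mem_set (conj cf vf : [set f | continuous f /\ vanishing f] f)).

(* The supremum norm; [sup set0 = 0] covers the empty space. *)
Definition C0_norm f : R[i] := (sup (range (fun x => complex.Re `|f x|)))%:C%C.

Lemma C0_norm_ub f x : `|f x| <= C0_norm f.
Proof.
have [M HM] := vanishing_bounded (@C0_continuous f) (@C0_vanishing f).
rewrite -Re_norm lecR; apply: sup_ubound; last by exists x.
by exists M => _ [y _ <-]; exact: HM.
Qed.

Lemma C0_norm_le f (M : R[i]) :
  0 <= M -> (forall x, `|f x| <= M) -> C0_norm f <= M.
Proof.
move=> M0 HM; have /eqP -> : M == (complex.Re M)%:C%C.
  by rewrite eq_sym; apply/eqP/RRe_real/ger0_real.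
have Mre : M = (complex.Re M)%:C%C by rewrite (RRe_real (ger0_real M0)).
rewrite lecR; have [[x _]|/set0P/negP/negPn/eqP H] := pselect ([set: X] !=set0).
  apply: ge_sup; first by exists (complex.Re `|f x|), x.
  by move=> _ [y _ <-]; rewrite -lecR Re_norm -Mre.
by rewrite H image_set0 sup0 -lecR -Mre.
Qed.

Lemma C0_norm_ge0 f : 0 <= C0_norm f.
Proof.
rewrite lecR; have [[x _]|/set0P/negP/negPn/eqP H] := pselect ([set: X] !=set0).
  by rewrite -lecR; exact: le_trans (normr_ge0 (f x)) (C0_norm_ub f x).
by rewrite H image_set0 sup0.
Qed.

Lemma C0_ler_normD f g : C0_norm (f + g) <= C0_norm f + C0_norm g.
Proof.
apply: C0_norm_le => [|x]; first by rewrite addr_ge0 ?C0_norm_ge0.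
by rewrite (le_trans (ler_normD (f x) (g x))) // lerD ?C0_norm_ub.
Qed.

Lemma C0_normZ_le (k : R[i]) f : C0_norm (k *: f) <= `|k| * C0_norm f.
Proof.
apply: C0_norm_le => [|x]; first by rewrite mulr_ge0 ?C0_norm_ge0.
by rewrite [X in `|X|](_ : _ = k * f x) // normrM ler_wpM2l ?C0_norm_ub.
Qed.

Lemma C0_normZ (k : R[i]) f : C0_norm (k *: f) = `|k| * C0_norm f.
Proof.
apply/eqP; rewrite eq_le C0_normZ_le /=.
have [->|k0] := eqVneq k 0; first by rewrite normr0 mul0r C0_norm_ge0.
rewrite -ler_pdivlMl ?normr_gt0 // -normfV.
by rewrite -{1}[f](scalerK k0) C0_normZ_le.
Qed.

Lemma C0_norm0_eq0 f : C0_norm f = 0 -> f = 0.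
Proof.
move=> f0; apply: C0_eqP => x.
by have := C0_norm_ub f x; rewrite f0 normr_le0 => /eqP.
Qed.

HB.instance Definition _ := Lmodule_isNormed.Build R[i] T
  C0_ler_normD C0_normZ C0_norm0_eq0.

Lemma C0_normE f : `|f| = C0_norm f. Proof. by []. Qed.

Lemma C0_cauchy_cvg (F : set_system T) :
  ProperFilter F -> cauchy F -> cvg F.
Proof.
move=> FF /cauchy_ballP Fc.
have pt x : cvg ((fun f : T => f x : C) @ F).
  apply: (@complex_cauchy_cvg R); apply/cauchy_ballP => e e0.
  move: (Fc e e0) => [[A B] /= [FA FB] AB].
  exists ([set f x | f in A], [set f x | f in B]).
    by split; [apply: filterS FA|apply: filterS FB] => f Hf /=; exists f.
  move=> [_ _] [[f Af <-] [g Bg <-]] /=.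
  have := AB (f, g) (conj Af Bg); rewrite -!ball_normE /= => fg.
  exact: (le_lt_trans (C0_norm_ub (f - g) x)).
pose l x : C := lim ((fun f : T => f x : C) @ F).
have unif (e : R[i]) : 0 < e ->
    F [set f : T | forall x, `|l x - f x| <= e].
  move=> e0; move: (Fc e e0) => [[A B] /= [FA FB] AB].
  apply: filterS FB => f Bf x /=.
  apply/ler_addgt0Pr => d d0.
  move/(@cvgrPdist_lt R[i] C) : (pt x) => /(_ _ d0) lFd.
  have [g [/= lg Ag]] := filter_ex (filterI lFd FA).
  have := AB (g, f) (conj Ag Bf); rewrite -ball_normE /= => gf.
  rewrite -(subrKA (g x)) addrC (le_trans (ler_normD _ _)) // lerD ?(ltW lg) //.
  exact: (le_trans (C0_norm_ub (g - f) x) (ltW gf)).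
have cl : continuous l.
  move=> x; apply/(@cvgrPdist_lt R[i] C) => e e0.
  have e30 : 0 < e / 2 / 2 by rewrite !divr_gt0.
  have [f lf] := filter_ex (unif _ e30).
  have e20 : 0 < e / 2 by rewrite divr_gt0.
  move/(@cvgrPdist_lt R[i] C) : (@C0_continuous f x) => /(_ _ e20).
  apply: filterS => y fxy.
  have lfx := lf x; have lfy := lf y; rewrite distrC in lfy.
  apply: (le_lt_trans (ler_distD (f x) (l x) (l y))).
  apply: (le_lt_trans (lerD lfx (ler_distD (f y) (f x) (l y)))).
  by rewrite addrC -addrA [ltRHS]splitr ltr_leD // [leRHS]splitr lerD.
have vl : vanishing l.
  move=> e e0; have e20 : 0 < e / 2 by rewrite divr_gt0.
  have [f lf] := filter_ex (unif _ e20).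
  apply: (subclosed_compact (closed_le_norm cl e0) (C0_vanishing e20)).
  move=> x /= le_e; rewrite -(lerD2r (e / 2)) -splitr (le_trans le_e) //.
  have := lerD (lexx `|f x|) (lf x); apply: le_trans.
  by rewrite -lerBlDl lerB_dist.
apply/cvg_ex; exists (mkC0 cl vl).
apply/cvgrPdist_le => e e0; near=> f.
rewrite C0_normE; apply: C0_norm_le; first exact: ltW.
move=> x; rewrite [X in `|X|](_ : _ = l x - f x) //; move: x; near: f.
exact: unif.
Unshelve. all: by end_near. Qed.

End C0_norm.

Section C0_cstar.
Variables (R : realType) (X : topologicalType).
Local Notation C := (R[i]^o).
Local Notation T := (C0 R X).
Implicit Types (f g : T) (h : X -> C).

HB.instance Definition _ := Uniform_isComplete.Build T (@C0_cauchy_cvg R X).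

Lemma vanishingM h (f : X -> C) (M : R[i]) : continuous h -> continuous f ->
  (forall x, `|h x| <= M) -> vanishing f -> vanishing (fun x => h x * f x : C).
Proof.
move=> ch cf hM vf; have k0 : 0 < `|M| + 1 by rewrite ltr_wpDl.
apply: (vanishing_le (continuousM_C ch cf) k0 _ vf) => x.
rewrite normrM ler_wpM2r // (le_trans (hM x)) //.
have Mr : M \is Num.real.
  by apply: ger0_real; exact: le_trans (normr_ge0 (h x)) (hM x).
by rewrite (le_trans (real_ler_norm Mr)) // lerDl.
Qed.

Lemma vanishingJ (f : X -> C) : continuous f -> vanishing f ->
  vanishing (fun x => Num.conj (f x) : C).
Proof.
move=> cf; apply: (vanishing_le (continuousJ_C cf) ltr01) => x.
by rewrite mul1r norm_conjC.
Qed.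

Definition C0_mul f g : T :=
  mkC0 (continuousM_C (@C0_continuous R X f) (@C0_continuous R X g))
    (vanishingM (@C0_continuous R X f) (@C0_continuous R X g)
      (C0_norm_ub f) (@C0_vanishing R X g)).

Definition C0_star f : T :=
  mkC0 (continuousJ_C (@C0_continuous R X f))
    (vanishingJ (@C0_continuous R X f) (@C0_vanishing R X f)).

Lemma C0_mulA : associative C0_mul.
Proof. by move=> f g k; apply: C0_eqP => x; exact: mulrA. Qed.

Lemma C0_mulDl : left_distributive C0_mul +%R.
Proof. by move=> f g k; apply: C0_eqP => x; exact: mulrDl. Qed.

Lemma C0_mulDr : right_distributive C0_mul +%R.
Proof. by move=> f g k; apply: C0_eqP => x; exact: mulrDr. Qed.

Lemma C0_mulZl (k : R[i]) f g : C0_mul (k *: f) g = k *: C0_mul f g.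
Proof. by apply: C0_eqP => x; exact: (esym (mulrA k (f x) (g x))). Qed.

Lemma C0_mulZr (k : R[i]) f g : C0_mul f (k *: g) = k *: C0_mul f g.
Proof. by apply: C0_eqP => x; exact: (mulrCA (f x) k (g x)). Qed.

Lemma C0_starK : involutive C0_star.
Proof. by move=> f; apply: C0_eqP => x; exact: conjCK. Qed.

Lemma C0_starD : {morph C0_star : f g / f + g}.
Proof. by move=> f g; apply: C0_eqP => x; exact: (rmorphD Num.conj). Qed.

Lemma C0_starZ (k : R[i]) f : C0_star (k *: f) = Num.conj k *: C0_star f.
Proof. by apply: C0_eqP => x; exact: (rmorphM Num.conj). Qed.

Lemma C0_starM f g : C0_star (C0_mul f g) = C0_mul (C0_star g) (C0_star f).
Proof.
by apply: C0_eqP => x; exact: etrans (rmorphM Num.conj _ _) (mulrC _ _).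
Qed.

HB.instance Definition _ := Lmodule_isStarAlg.Build R T
  C0_mulA C0_mulDl C0_mulDr C0_mulZl C0_mulZr C0_starK C0_starD C0_starZ C0_starM.

Lemma C0_norm_mul_le f g : `|f ** g| <= `|f| * `|g|.
Proof.
apply: C0_norm_le => [|x]; first by rewrite mulr_ge0.
by rewrite normrM ler_pM // C0_norm_ub.
Qed.

Lemma C0_cstar_identity f : `|star f ** f| = `|f| ^+ 2.
Proof.
apply/eqP; rewrite eq_le; apply/andP; split.
  apply: C0_norm_le => [|x]; first by rewrite exprn_ge0.
  by rewrite normrM norm_conjC -expr2 lerXn2r ?nnegrE // C0_norm_ub.
rewrite -[leRHS]sqrtCK lerXn2r ?nnegrE ?sqrtC_ge0 //.
apply: C0_norm_le => [|x]; first by rewrite sqrtC_ge0.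
rewrite -[leLHS](sqrCK (normr_ge0 _)) ler_sqrtC ?nnegrE ?exprn_ge0 //.
have := C0_norm_ub (star f ** f) x.
by rewrite [X in `|X|](_ : _ = Num.conj (f x) * f x) // normrM norm_conjC -expr2.
Qed.

HB.instance Definition _ := StarAlg_isCstar.Build R T
  C0_norm_mul_le C0_cstar_identity.
End C0_cstar.

Section multiplier.
Variables (R : realType) (B : cstarType R).

(* The multiplier algebra as Busby's algebra of double centralizers: linearity
   (below) and boundedness (closed graph theorem) of both maps follow from
   [multP], so they are not required. Morphisms into it only involve its
   *-algebra structure; its norm is not needed. *)
Record multiplier := Multiplier {
  lmult :> B -> B;
  rmult : B -> B;
  multP : forall x y : B, x ** lmult y = rmult x ** y
}.
Implicit Types S T : multiplier.

Lemma amul0r (x : B) : x ** 0 = 0.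
Proof. by have := amulZr 0 x 0; rewrite !scale0r. Qed.

Lemma amul0l (x : B) : 0 ** x = 0.
Proof. by have := amulZl 0 0 x; rewrite !scale0r. Qed.

Lemma amulBr (x y z : B) : x ** (y - z) = x ** y - x ** z.
Proof. by rewrite -[- z]scaleN1r -[- (x ** z)]scaleN1r amulDr amulZr. Qed.

Lemma amulBl (x y z : B) : (y - z) ** x = y ** x - z ** x.
Proof. by rewrite -[- z]scaleN1r -[- (z ** x)]scaleN1r amulDl amulZl. Qed.

Lemma star_amul_eq0 (x : B) : star x ** x = 0 -> x = 0.
Proof.
move=> x0; have := cstar_identity x; rewrite x0 normr0 => /esym/eqP.
by rewrite expf_eq0 /= normr_eq0 => /eqP.
Qed.

Lemma amul_injl (x y : B) : (forall z, z ** x = z ** y) -> x = y.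
Proof.
move=> xy; apply/eqP; rewrite -subr_eq0; apply/eqP/star_amul_eq0.
by rewrite amulBr xy subrr.
Qed.

Lemma star_inj : injective (@star R B).
Proof. exact: inv_inj (@starK R B). Qed.

Lemma amul_injr (x y : B) : (forall z, x ** z = y ** z) -> x = y.
Proof.
move=> xy; apply: star_inj; apply: amul_injl => z.
by apply: star_inj; rewrite !starM !starK.
Qed.

Lemma mult_eqP S T : (forall x, S x = T x) -> S = T.
Proof.
move=> ST; have {}ST : lmult S = lmult T by apply/funext.
have rST : rmult S = rmult T.
  by apply/funext => x; apply: amul_injr => y; rewrite -!multP ST.
case: S T ST rST => [l r p] [l' r' p'] /= ll rr; rewrite -ll -rr in p' *.
by congr Multiplier; exact: Prop_irrelevance.
Qed.

Lemma lmultD T : {morph lmult T : x y / x + y}.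
Proof. by move=> x y; apply: amul_injl => z; rewrite multP !amulDr !multP. Qed.

Lemma lmultZ T (k : R[i]) : {morph lmult T : x / k *: x}.
Proof. by move=> x; apply: amul_injl => z; rewrite multP !amulZr multP. Qed.

Lemma rmultD T : {morph rmult T : x y / x + y}.
Proof. by move=> x y; apply: amul_injr => z; rewrite -multP !amulDl -!multP. Qed.

Lemma rmultZ T (k : R[i]) : {morph rmult T : x / k *: x}.
Proof. by move=> x; apply: amul_injr => z; rewrite -multP !amulZl -multP. Qed.

Fact mult0P (x y : B) : x ** 0 = 0 ** y.
Proof. by rewrite amul0r amul0l. Qed.
Definition mult0 : multiplier := Multiplier mult0P.

Fact multDP S T x y : x ** (S y + T y) = (rmult S x + rmult T x) ** y.
Proof. by rewrite amulDr amulDl !multP. Qed.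
Definition multD S T : multiplier := Multiplier (multDP S T).

Fact multZP (k : R[i]) T x y : x ** (k *: T y) = (k *: rmult T x) ** y.
Proof. by rewrite amulZr amulZl multP. Qed.
Definition multZ (k : R[i]) T : multiplier := Multiplier (multZP k T).

Fact multMP S T x y : x ** (S (T y)) = (rmult T (rmult S x)) ** y.
Proof. by rewrite !multP. Qed.
Definition multM S T : multiplier := Multiplier (multMP S T).

Fact multJP T x y :
  x ** star (rmult T (star y)) = star (T (star x)) ** y.
Proof. by apply: star_inj; rewrite !starM !starK multP. Qed.
Definition mult_star T : multiplier := Multiplier (multJP T).

HB.instance Definition _ := gen_eqMixin multiplier.
HB.instance Definition _ := gen_choiceMixin multiplier.

Let multN T := multZ (-1) T.

Fact multDA : associative multD.
Proof. by move=> S T U; apply: mult_eqP => x; exact: addrA. Qed.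
Fact multDC : commutative multD.
Proof. by move=> S T; apply: mult_eqP => x; exact: addrC. Qed.
Fact mult0D : left_id mult0 multD.
Proof. by move=> S; apply: mult_eqP => x; exact: add0r. Qed.
Fact multND : left_inverse mult0 multN multD.
Proof. by move=> S; apply: mult_eqP => x; rewrite /= scaleN1r addNr. Qed.

HB.instance Definition _ :=
  GRing.isZmodule.Build multiplier multDA multDC mult0D multND.

Fact multZA (k l : R[i]) T : multZ k (multZ l T) = multZ (k * l) T.
Proof. by apply: mult_eqP => x; exact: scalerA. Qed.
Fact mult1Z : left_id 1 multZ.
Proof. by move=> T; apply: mult_eqP => x; exact: scale1r. Qed.
Fact multZDr : right_distributive multZ +%R.
Proof. by move=> k S T; apply: mult_eqP => x; exact: scalerDr. Qed.
Fact multZDl T : {morph multZ^~ T : k l / k + l}.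
Proof. by move=> k l; apply: mult_eqP => x; exact: scalerDl. Qed.

HB.instance Definition _ := GRing.Zmodule_isLmodule.Build R[i] multiplier
  multZA mult1Z multZDr multZDl.

Fact multMA : associative multM.
Proof. by move=> S T U; exact: mult_eqP. Qed.
Fact multMDl : left_distributive multM +%R.
Proof. by move=> S T U; exact: mult_eqP. Qed.
Fact multMDr : right_distributive multM +%R.
Proof. by move=> S T U; apply: mult_eqP => x; exact: lmultD. Qed.
Fact multMZl (k : R[i]) S T : multM (k *: S) T = k *: multM S T.
Proof. exact: mult_eqP. Qed.
Fact multMZr (k : R[i]) S T : multM S (k *: T) = k *: multM S T.
Proof. by apply: mult_eqP => x; exact: lmultZ. Qed.
Fact mult_starK : involutive mult_star.
Proof. by move=> T; apply: mult_eqP => x /=; rewrite !starK. Qed.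
Fact mult_starD : {morph mult_star : S T / S + T}.
Proof. by move=> S T; apply: mult_eqP => x; exact: starD. Qed.
Fact mult_starZ (k : R[i]) T : mult_star (k *: T) = Num.conj k *: mult_star T.
Proof. by apply: mult_eqP => x; exact: starZ. Qed.
Fact mult_starM S T :
  mult_star (multM S T) = multM (mult_star T) (mult_star S).
Proof. by apply: mult_eqP => x /=; rewrite !starK. Qed.

HB.instance Definition _ := Lmodule_isStarAlg.Build R multiplier
  multMA multMDl multMDr multMZl multMZr
  mult_starK mult_starD mult_starZ mult_starM.

Definition mult_of (b : B) : multiplier :=
  @Multiplier (fun x => b ** x) (fun x => x ** b) (fun x y => amulA x b y).

End multiplier.

Definition star_hom (R : realType) (A B : starAlgType R) (phi : A -> B) : Prop :=
  [/\ forall (k : R[i]) (x y : A), phi (k *: x + y) = k *: phi x + phi y,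
      {morph phi : x y / x ** y} & {morph phi : x / star x}].

Definition subspace_of (K : pzRingType) (V : lmodType K) (S : set V) : Prop :=
  S 0 /\ forall (k : K) (x y : V), S x -> S y -> S (k *: x + y).

Definition lin_span (K : pzRingType) (V : lmodType K) (S : set V) : set V :=
  \bigcap_(W in [set W | subspace_of W /\ S `<=` W]) W.

Section morphisms.
Variables (R : realType) (A B : cstarType R).

Definition Mor : set (A -> multiplier B) :=
  [set phi : A -> multiplier B | star_hom phi /\
    closure (lin_span [set phi a b | a in [set: A] & b in [set: B]]) = setT].

(* Proper morphisms are taken as *-homomorphisms A -> B, not as morphisms into
   the multiplier algebra of B with range in B. *)
Definition Morp : set (A -> B) :=
  [set psi : A -> B | star_hom psi /\
    closure (lin_span [set psi a ** b | a in [set: A] & b in [set: B]]) = setT].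

Definition Pim (phi : A -> multiplier B) : set A :=
  phi @^-1` range (@mult_of R B).

End morphisms.

Section ideals.
Variables (R : realType) (B C : cstarType R).

Definition is_ideal (I : set C) : Prop :=
  [/\ subspace_of I, closed I &
      forall c x : C, I x -> I (c ** x) /\ I (x ** c)].

(* Elements of the quotient C / I are represented by cosets, as subsets of C. *)
Definition coset (I : set C) (c : C) : set C := [set c + x | x in I].

Definition annihilator (I : set C) : set C :=
  [set c | forall b, I b -> c ** b = 0].

Definition ideal_embedding (iota : B -> C) : Prop :=
  [/\ star_hom iota, injective iota & is_ideal (range iota)].

Variables (iota : B -> C) (iotaP : ideal_embedding iota).

Fact induced_ex (c : C) (b : B) :
  exists bb : B * B, iota bb.1 = c ** iota b /\ iota bb.2 = iota b ** c.
Proof.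
have [_ _ [_ _ /(_ c (iota b)) [|[b1 _ e1] [b2 _ e2]]]] := iotaP; first by exists b.
by exists (b1, b2).
Qed.

Definition induced_l (c : C) (b : B) : B := (sval (cid (induced_ex c b))).1.
Definition induced_r (c : C) (b : B) : B := (sval (cid (induced_ex c b))).2.

Lemma iota_induced_l c b : iota (induced_l c b) = c ** iota b.
Proof. by rewrite /induced_l; case: cid => ? []. Qed.

Lemma iota_induced_r c b : iota (induced_r c b) = iota b ** c.
Proof. by rewrite /induced_r; case: cid => ? []. Qed.

Fact induced_multP c x y : x ** induced_l c y = induced_r c x ** y.
Proof.
have [[_ iM _] iI _] := iotaP; apply: iI.
by rewrite !iM iota_induced_l iota_induced_r amulA.
Qed.

(* The morphism alpha_C, with B identified with the ideal [range iota]. *)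
Definition induced_mor (c : C) : multiplier B := Multiplier (induced_multP c).

End ideals.

(* [iota] identifies B with an ideal of C; both (NF1) and (NF2) refer to it. *)
Definition nc_fibrewise_compactification (R : realType) (A B C : cstarType R)
    (phi : A -> multiplier B) (psi : A -> C) : Prop :=
  Morp psi /\
  exists (iota : B -> C) (iotaP : ideal_embedding iota),
    induced_mor iotaP \o psi = phi /\
    [set coset (range iota) c | c in annihilator (range iota)] `<=`
      [set coset (range iota) (psi a) | a in Pim phi].

Definition nc_perfection (R : realType) (A B C : cstarType R)
    (phi : A -> multiplier B) (psi : A -> C) : Prop :=
  nc_fibrewise_compactification phi psi /\ injective psi.

Definition proper_map (X Y : topologicalType) (f : X -> Y) : Prop :=
  forall K, compact K -> compact (f @^-1` K).

Definition open_inclusion (X Z : topologicalType) (iota : X -> Z) : Prop :=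
  [/\ continuous iota, injective iota &
      forall U, open U -> open (iota @` U)].

Definition Prp (X Y : topologicalType) (f : X -> Y) : set Y :=
  \bigcup_(W in [set W | [/\ open W, precompact W &
                            compact (f @^-1` closure W)]]) W.

(* Continuity of the inverse of [g] restricted to [S] is expressed by relative
   openness, since no function Y -> Z need exist when Z is empty. *)
Definition homeo_on (Z Y : topologicalType) (S : set Z) (g : Z -> Y) : Prop :=
  [/\ {in S &, injective g}, {within S, continuous g} &
      forall U, open U -> exists2 V, open V & g @` (U `&` S) = V `&` g @` S].

Record fibrewise_compactification (X Y Z : topologicalType)
    (f : X -> Y) (g : Z -> Y) : Prop := {
  fc_hausdorff : hausdorff_space Z;
  fc_locally_compact : locally_compact [set: Z];
  fc_continuous : continuous g;
  fc_proper : proper_map g;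
  fc_inclusion : exists iota : X -> Z,
    let S := ~` closure (range iota) in
    [/\ open_inclusion iota, g \o iota = f, homeo_on S g,
        g @` S `<=` Prp f & exists2 F, closed F & g @` S = F `&` Prp f]
}.

Definition perfection (X Y Z : topologicalType) (f : X -> Y) (g : Z -> Y) : Prop :=
  fibrewise_compactification f g /\ range g = setT.

Section bounded_functions.
Variables (R : realType) (X : topologicalType).
Local Notation C := (R[i]^o).

Record Cb := MkCb {
  Cb_fun :> X -> C;
  Cb_continuous : continuous Cb_fun;
  Cb_bounded : exists M : R[i], forall x, `|Cb_fun x| <= M
}.

Definition Cb_mul (h : Cb) (b : C0 R X) : C0 R X :=
  mkC0 (continuousM_C (@Cb_continuous h) (@C0_continuous R X b))
    (vanishingM (@Cb_continuous h) (@C0_continuous R X b)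
      (svalP (cid (Cb_bounded h))) (@C0_vanishing R X b)).

Fact Cb_multP (h : Cb) (x y : C0 R X) : x ** Cb_mul h y = Cb_mul h x ** y.
Proof.
by apply: C0_eqP => t; rewrite /= mulrA [X in X * _ = _]mulrC.
Qed.

(* The identification of C_b(X) with the multiplier algebra of C_0(X). *)
Definition Cb_mult (h : Cb) : multiplier (C0 R X) := Multiplier (Cb_multP h).

End bounded_functions.

Section pullback.
Variables (R : realType) (X Y : topologicalType) (f : X -> Y).
Hypothesis cf : continuous f.

Fact comp_C_continuous (a : C0 R Y) : continuous (a \o f : X -> R[i]^o).
Proof. by move=> x; apply: continuous_comp; [exact: cf|exact: C0_continuous]. Qed.

Fact comp_C_bounded (a : C0 R Y) :
  exists M : R[i], forall x, `|(a \o f) x| <= M.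
Proof. by exists (C0_norm a) => x; exact: C0_norm_ub. Qed.

(* f^* : C_0(Y) -> C_b(X), seen in the multiplier algebra of C_0(X). *)
Definition pullback (a : C0 R Y) : multiplier (C0 R X) :=
  Cb_mult (MkCb (@comp_C_continuous a) (comp_C_bounded a)).

Hypothesis pf : proper_map f.

Fact comp_C_vanishing (a : C0 R Y) : vanishing (a \o f : X -> R[i]^o).
Proof. by move=> e e0; exact: (pf (C0_vanishing e0)). Qed.

Definition proper_pullback (a : C0 R Y) : C0 R X :=
  mkC0 (@comp_C_continuous a) (@comp_C_vanishing a).

End pullback.

Section spectrum.
Variables (R : realType) (C : cstarType R).

Record character := Character {
  char_fun :> C -> R[i];
  charD : {morph char_fun : x y / x + y};
  charZ : forall (k : R[i]) (x : C), char_fun (k *: x) = k * char_fun x;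
  charM : forall x y : C, char_fun (x ** y) = char_fun x * char_fun y;
  char_neq0 : exists x : C, char_fun x != 0
}.

HB.instance Definition _ := gen_eqMixin character.
HB.instance Definition _ := gen_choiceMixin character.

Definition spectrum : Type := character.

HB.instance Definition _ := Topological.copy spectrum
  (initial_topology (char_fun : character -> {ptws C -> R[i]^o})).

End spectrum.

(* [g] is the map psi_*: for chi in the spectrum of C, the character chi \o psi
   of C_0(Y) is evaluation at the point [g chi] of Y. When Y is locally compact
   Hausdorff this determines [g], as C_0(Y) separates points. *)
Definition gelfand_dual (R : realType) (Y : topologicalType) (C : cstarType R)
    (psi : C0 R Y -> C) (g : spectrum C -> Y) : Prop :=
  forall (chi : spectrum C) (a : C0 R Y),
    a (g chi) = (chi : character C) (psi a).

(* Main.v *)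
(* From [Z] to [C]: [B = C_0(X)] sits in [C_0(Z)] by extension by zero, and its
   annihilator consists of the functions living on [S = Z \ closure X]. Over
   [Prp f] the map [f] is already proper, so no boundary point of [X] in [Z]
   lies over [Prp f]; since [g] maps [S] homeomorphically onto a closed subset
   of [Prp f], a function [c] on [S] can be pushed forward to [g S] and, by
   Tietze's theorem on the one-point compactification of [Y], extended to some
   [a] in [C_0(Y)] vanishing off [Prp f]. Then [a \o f] is in [C_0(X)] and
   [a \o g - c] vanishes off [X], which is (NF2).

   From [C] to [Z]: let [J] be the annihilator of [B]. Commutators of [C] lie
   in [J] because multipliers of [B] commute, and [J] is commutative by (NF2)
   because [J] meets [B] trivially; a commutative ideal is central, so [J]
   kills all commutators and [C] is commutative. In the spectrum of [C], the
   characters not vanishing on [B] are the points of [X], and those not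
   vanishing on [J] are determined by their image in [Y] by (NF2). It remains
   to see that the latter are exactly the points off the closure of [X]. This
   uses one piece of functional calculus: a self-adjoint contraction [T] in the
   multipliers of [C] has an absolute value [|T|], obtained by iterating the
   square root twice ([T + i sqrt (1 - T^2)] is unitary, so [sqrt (1 - T^2)] is
   again a contraction), and [|T| - T] vanishes at all characters where
   [T >= 0]. *)
Require Import Defs.
From HB Require Import structures.
From mathcomp Require Import all_boot all_order all_algebra.
From mathcomp Require Import complex ring.
From mathcomp Require Import all_classical all_reals all_analysis.

Set Implicit Arguments.
Unset Strict Implicit.
Unset Printing Implicit Defensive.

Import Order.TTheory GRing.Theory Num.Theory.
Import numFieldNormedType.Exports.

Local Open Scope classical_set_scope.
Local Open Scope ring_scope.

(** * Complex-valued functions and cut-off functions *)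

Section complex_valued.
Variables (R : realType) (T : topologicalType).
Local Notation C := (R[i]^o).

Lemma continuous_complex (g h : T -> R) : continuous g -> continuous h ->
  continuous (fun x => (g x +i* h x)%C : C).
Proof.
move=> cg ch x; apply/(@cvgrPdist_lt R[i] C) => -[e e'].
rewrite ltcE /= => /andP[/eqP -> e0].
have e20 : 0 < e / 2 by rewrite divr_gt0.
move/cvgrPdist_lt : (cg x) => /(_ _ e20) gx.
move/cvgrPdist_lt : (ch x) => /(_ _ e20) hx.
near=> y; apply: (le_lt_trans (ler_norm_ReIm _)).
rewrite (_ : (e +i* 0)%C = e%:C%C) // ltcR /= (splitr e) ltrD //.
  by near: y.
by near: y.
Unshelve. all: by end_near. Qed.

Lemma continuous_real_complex (g : T -> R) : continuous g ->
  continuous (fun x => (g x)%:C%C : C).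
Proof. by move=> cg; apply: continuous_complex => // x; exact: cvg_cst. Qed.

Lemma Re_continuous (g : T -> C) : continuous g ->
  continuous (fun x => complex.Re (g x)).
Proof.
move=> cg x; apply/cvgrPdist_lt => e e0.
have eC : (0 : R[i]) < e%:C%C by rewrite ltcR.
move/(@cvgrPdist_lt R[i] C) : (cg x) => /(_ _ eC); apply: filterS => y xy.
by rewrite -ltcR (le_lt_trans _ xy) // -raddfB ler_Re_norm.
Qed.

Lemma Im_continuous (g : T -> C) : continuous g ->
  continuous (fun x => complex.Im (g x)).
Proof.
move=> cg x; apply/cvgrPdist_lt => e e0.
have eC : (0 : R[i]) < e%:C%C by rewrite ltcR.
move/(@cvgrPdist_lt R[i] C) : (cg x) => /(_ _ eC); apply: filterS => y xy.
by rewrite -ltcR (le_lt_trans _ xy) // -raddfB ler_Im_norm.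
Qed.

Lemma Re_norm_continuous (g : T -> C) : continuous g ->
  continuous (fun x => complex.Re `|g x|).
Proof.
move=> cg x; apply/cvgrPdist_lt => e e0.
have eC : (0 : R[i]) < e%:C%C by rewrite ltcR.
move/(@cvgrPdist_lt R[i] C) : (cg x) => /(_ _ eC); apply: filterS => y xy.
rewrite -ltcR (le_lt_trans _ xy) // -raddfB (le_trans (ler_Re_norm _)) //.
exact: ler_dist_dist.
Qed.

End complex_valued.

Lemma closed_norm_le (R : realType) (T : topologicalType) (g : T -> R[i]^o)
    (M : R[i]) : continuous g -> closed [set x | `|g x| <= M].
Proof.
move=> cg; have [M0|nM0] := boolP (0 <= M); last first.
  rewrite (_ : mkset _ = set0); first exact: closed0.
  by apply/seteqP; split=> z //= zM; move/negP : nM0; apply; exact: le_trans zM.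
have eM : M = (complex.Re M)%:C%C by rewrite (RRe_real (ger0_real M0)).
rewrite (_ : mkset _ =
    (fun x => complex.Re `|g x|) @^-1` [set r | r <= complex.Re M]).
  apply: closed_comp; last exact: closed_le.
  by move=> x _; exact: Re_norm_continuous.
by apply/seteqP; split=> x /=; rewrite -lecR Re_norm -eM.
Qed.

Lemma closed_disc_compact (R : realType) (M : R[i]) :
  compact [set z : R[i]^o | `|z| <= M].
Proof.
have [M0|nM0] := boolP (0 <= M); last first.
  rewrite (_ : mkset _ = set0); first exact: compact0.
  by apply/seteqP; split=> z //= zM; move/negP : nM0; apply; exact: le_trans zM.
have eM : M = (complex.Re M)%:C%C by rewrite (RRe_real (ger0_real M0)).
pose I : set R := `[(- complex.Re M), (complex.Re M)]%classic.
pose h (p : R * R) : R[i]^o := (p.1 +i* p.2)%C.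
have ch : continuous h.
  by apply: continuous_complex => p; [exact: cvg_fst|exact: cvg_snd].
have cI : compact (h @` (I `*` I)).
  apply: continuous_compact; first exact: continuous_subspaceT.
  by apply: compact_setX; exact: segment_compact.
apply: (subclosed_compact _ cI).
  by apply: (@closed_norm_le R R[i]^o id) => z.
move=> -[a b] /= zM; exists (a, b) => //.
have := le_trans (ler_Re_norm (a +i* b)%C) zM.
have := le_trans (ler_Im_norm (a +i* b)%C) zM.
by rewrite eM !lecR /= !ler_norml /I /= !in_itv /=; split.
Qed.

Section cutoff.
Variables (R : realType) (Y : topologicalType).
Hypotheses (hY : hausdorff_space Y) (lcY : locally_compact [set: Y]).
Local Notation Yp := (one_point_compactification Y).

Lemma one_point_compactification_normal : normal_space Yp.
Proof.
apply: compact_normal; first exact: one_point_compactification_hausdorff.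
exact: one_point_compactification_compact.
Qed.

Lemma compact_Some_closed (K : set Y) : compact K -> closed (Some @` K : set Yp).
Proof.
move=> cK; apply: compact_closed.
  exact: one_point_compactification_hausdorff.
apply: continuous_compact => //; apply: continuous_subspaceT.
exact: one_point_compactification_some_continuous.
Qed.

Lemma preimage_Some_compact (A : set Yp) :
  closed A -> ~ A None -> compact (Some @^-1` A).
Proof.
move=> cA AN; have : nbhs (None : Yp) (~` A).
  by apply: open_nbhs_nbhs; split => //; exact: closed_openC.
case=> K [cK _] KA; apply: (subclosed_compact _ cK).
  apply: (@closed_comp Y Yp Some) => // x _.
  exact: one_point_compactification_some_continuous.
move=> y /= Ay; apply: contrapT => nKy; apply: (KA (Some y)) => //.
by left; exists y.
Qed.

Lemma vanishing_Some (h : Yp -> R[i]^o) : continuous h -> h None = 0 ->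
  vanishing (h \o Some : Y -> R[i]^o).
Proof.
move=> ch hN e e0; apply: (@preimage_Some_compact [set p | e <= `|h p|]).
  exact: closed_le_norm.
by rewrite /= hN normr0 => /(lt_le_trans e0); rewrite ltxx.
Qed.

Lemma comp_Some_continuous (T : topologicalType) (h : Yp -> T) :
  continuous h -> continuous (h \o Some : Y -> T).
Proof.
move=> ch x; apply: continuous_comp; last exact: ch.
exact: one_point_compactification_some_continuous.
Qed.

(** Urysohn's lemma in the one-point compactification: the closed set sent to 0, the complement of
    [U], contains infinity, so the restriction to [Y] vanishes at infinity. *)
Lemma C0_cutoff (K U : set Y) : compact K -> open U -> K `<=` U ->
  exists a : C0 R Y, [/\ forall y, 0 <= a y <= 1,
    forall y, K y -> a y = 1 & forall y, ~ U y -> a y = 0].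
Proof.
move=> cK oU KU.
have cU : closed (~` (Some @` U) : set Yp).
  by apply: open_closedC; exact: one_point_compactification_open_some.
have KU0 : ~` (Some @` U) `&` (Some @` K) = set0.
  by apply/seteqP; split=> // p [nU [y Ky yp]]; apply: nU; exists y => //; exact: KU.
have /normal_separatorP/(_ _ _ cU (compact_Some_closed cK) KU0) :=
  one_point_compactification_normal.
move=> /(_ R) /(@uniform_separatorP _ R)[h [ch h01 h0 h1]].
have chC := continuous_real_complex ch.
have hN : h None = 0 by apply: h0; exists None => // -[].
have vh : vanishing ((fun p => (h p)%:C%C : R[i]^o) \o Some).
  by apply: vanishing_Some => //=; rewrite hN.
pose a := mkC0 (comp_Some_continuous chC) vh.
have aE y : a y = (h (Some y))%:C%C by [].
exists a; split => y; rewrite aE.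
- have : range h (h (Some y)) by exists (Some y).
  by move=> /h01; rewrite [`[0, 1]%classic _]/= in_itv [X in X -> _]/= -!lecR.
- by move=> Ky; rewrite (h1 (h (Some y))) //; exists (Some y) => //; exists y.
- move=> nUy; rewrite (h0 (h (Some y))) //.
  by exists (Some y) => // -[z Uz [zy]]; apply: nUy; rewrite -zy.
Qed.

Lemma C0_separate (y y' : Y) : y <> y' ->
  exists a : C0 R Y, a y = 1 /\ a y' = 0.
Proof.
move=> yy'; have cl : closed [set y'].
  by apply: accessible_closed_set1; exact: hausdorff_accessible.
have [|a [_ a1 a0]] := C0_cutoff (@compact_set1 _ y) (closed_openC cl).
  by move=> _ ->.
by exists a; split; [exact: a1|apply: a0 => /=; exact].
Qed.

Lemma C0_sep_inj (y y' : Y) : (forall a : C0 R Y, a y = a y') -> y = y'.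
Proof.
move=> ayy'; apply: contrapT => /C0_separate[a [a1 a0]].
by have := ayy' a; rewrite a1 a0 => /eqP; rewrite oner_eq0.
Qed.

Lemma C0_bump (y : Y) (U : set Y) : open U -> U y ->
  exists a : C0 R Y, [/\ forall z, 0 <= a z <= 1, a y = 1 &
    forall z, a z != 0 -> U z].
Proof.
move=> oU Uy; have [|a [a01 a1 a0]] := C0_cutoff (@compact_set1 _ y) oU.
  by move=> _ ->.
exists a; split => //; first exact: a1.
by move=> z /eqP az; apply: contrapT => /a0.
Qed.

End cutoff.

(** * From fibrewise compactifications to C*-algebras *)

Lemma Prp_open (X Y : topologicalType) (f : X -> Y) : open (Prp f).
Proof. by apply: bigcup_open => W []. Qed.

Lemma ultra_cvg_compact (T V : topologicalType) (F : set_system T) (h : T -> V)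
    (K : set V) : UltraFilter F -> compact K -> F (h @^-1` K) ->
  exists2 l, K l & h @ F --> l.
Proof.
move=> FU cK FK; have [l [Kl Fl]] := cK (h @ F) _ FK.
exists l => // B lB; have [//|FnB] := in_ultra_setVsetC (h @^-1` B) FU.
by have [v []] := Fl (~` B) B FnB lB.
Qed.

(** An ultrafilter on the preimage of [L] is pushed to a limit [y] in [L]. It contains the preimage
    of some [W] around [y] from the definition of [Prp f], hence converges in the compact preimage
    of [closure W]. *)
Lemma preimage_Prp_compact (X Y : topologicalType) (f : X -> Y) (L : set Y) :
  hausdorff_space Y -> continuous f -> compact L -> L `<=` Prp f ->
  compact (f @^-1` L).
Proof.
move=> hY cf cL LP; rewrite compact_ultra => F FU FL.
have [y Ly Fy] := ultra_cvg_compact FU cL FL; have [W [oW _ cW] Wy] := LP y Ly.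
have FW : F (f @^-1` W) by apply: Fy; exact: open_nbhs_nbhs.
have cLW : compact (f @^-1` closure W `&` f @^-1` L).
  apply: compact_closedI => //; apply: closed_comp; first by move=> x _; exact: cf.
  exact: compact_closed.
move: cLW; rewrite compact_ultra => /(_ F FU)[|x [[_ Lx] Fx]]; last by exists x.
apply: filterI => //; apply: filterS FW => x Wx; exact: (@subset_closure _ W).
Qed.

(* Over [Prp f], [f] is already proper, so [iota X] is closed there and no
   boundary point of [iota X] can lie over [Prp f]. *)
Lemma closure_over_Prp (X Y Z : topologicalType) (f : X -> Y) (g : Z -> Y)
    (iota : X -> Z) (z : Z) : hausdorff_space Z -> continuous g ->
  continuous iota -> (forall x, g (iota x) = f x) ->
  closure (range iota) z -> Prp f (g z) -> range iota z.
Proof.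
move=> hZ cg ci gi clz [W [oW _ cW] Wz].
have : closure (iota @` (f @^-1` closure W)) z.
  move=> B Bz; have /clz[_ [[x _ <-] [Bx Wx]]] : nbhs z (B `&` g @^-1` W).
    by apply: filterI => //; apply: cg; exact: open_nbhs_nbhs.
  exists (iota x); split => //; exists x => //.
  by apply: subset_closure; rewrite -gi.
suff /closure_id <- : closed (iota @` (f @^-1` closure W)).
  by move=> [x _ <-]; exists x.
apply: compact_closed => //; apply: continuous_compact => //.
exact: continuous_subspaceT.
Qed.

Lemma closure_span_setT (K : numFieldType) (V : normedModType K) (S : set V) :
  (forall (b : V) (e : K), 0 < e -> exists2 s, S s & `|b - s| < e) ->
  closure (lin_span S) = setT.
Proof.
move=> HS; apply/seteqP; split=> // b _ B /nbhs_ballP[e /= e0 eB].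
have [s Ss bs] := HS b e e0; exists s; split; last first.
  by apply: eB; rewrite -ball_normE.
by move=> W [_]; apply.
Qed.

(** * Nondegeneracy of pullbacks *)

Section pullback_morphism.
Variables (R : realType) (X Y : topologicalType) (f : X -> Y).
Hypotheses (hY : hausdorff_space Y) (lcY : locally_compact [set: Y]).
Hypothesis cf : continuous f.

(** Take [a] equal to 1 on the image of the compact set where |b| >= e; elsewhere 0 <= 1 - a <= 1,
    so the error is at most |b| < e. *)
Lemma C0_approx_unit (b : C0 R X) (e : R[i]) : 0 < e ->
  exists a : C0 R Y, forall x, `|b x - a (f x) * b x| <= e.
Proof.
move=> e0; have cK : compact (f @` [set x | e <= `|b x|]).
  apply: continuous_compact; first exact: continuous_subspaceT.
  exact: C0_vanishing.
have [a [a01 a1 _]] := C0_cutoff R hY lcY cK openT (fun _ _ => I).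
exists a => x; have [xe|xe] := real_leP (gtr0_real e0) (normr_real (b x)).
  by rewrite a1 ?mul1r ?subrr ?normr0 ?(ltW e0) //; exists x.
have /andP[ax0 ax1] := a01 (f x).
rewrite -[X in X - _]mul1r -mulrBl normrM ger0_norm ?subr_ge0 //.
by rewrite (le_trans _ (ltW xe)) // ler_piMl // gerBl.
Qed.

Lemma pullback_Mor : Mor (pullback (R := R) cf).
Proof.
split.
  split=> [k x y|x y|x]; apply: mult_eqP => b; apply: C0_eqP => t.
  - by rewrite /= [LHS]mulrDl; congr (_ + _); rewrite -mulrA.
  - exact: (esym (mulrA _ _ _)).
  - rewrite [RHS](_ : _ = Num.conj (x (f t) * Num.conj (b t))) //.
    by rewrite rmorphM; congr (_ * _); exact/esym/conjCK.
apply: closure_span_setT => b e e0.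
have e20 : 0 < e / 2 by rewrite divr_gt0.
have [a ab] := C0_approx_unit b e20.
exists (pullback cf a b); first by exists a => //; exists b.
rewrite (@le_lt_trans _ _ (e / 2)) //; last first.
  by rewrite ltr_pdivrMr // ltr_pMr // ltr1n.
by rewrite C0_normE; apply: C0_norm_le => //; exact: ltW.
Qed.

Hypothesis pf : proper_map f.

Lemma proper_pullback_Morp : Morp (proper_pullback (R := R) cf pf).
Proof.
split; first by split=> [k x y|x y|x]; exact: C0_eqP.
apply: closure_span_setT => b e e0.
have e20 : 0 < e / 2 by rewrite divr_gt0.
have [a ab] := C0_approx_unit b e20.
exists (proper_pullback cf pf a ** b); first by exists a => //; exists b.
rewrite (@le_lt_trans _ _ (e / 2)) //; last first.
  by rewrite ltr_pdivrMr // ltr_pMr // ltr1n.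
by rewrite C0_normE; apply: C0_norm_le => //; exact: ltW.
Qed.

End pullback_morphism.

(** * C_0(X) as an ideal of C_0(Z) *)

Section extension_by_zero.
Variables (R : realType) (X Z : topologicalType) (iota : X -> Z).
Hypotheses (hZ : hausdorff_space Z) (oi : open_inclusion iota).
Local Notation C := (R[i]^o).

Definition extend0 (b : X -> C) (z : Z) : C :=
  if pselect (exists x, iota x = z) is left e then b (sval (cid e)) else 0.

Lemma extend0_in b x : extend0 b (iota x) = b x.
Proof.
have [_ inj _] := oi; rewrite /extend0; case: pselect => [e|]; last first.
  by case; exists x.
by congr b; apply: inj; exact: (svalP (cid e)).
Qed.

Lemma extend0_out b z : ~ range iota z -> extend0 b z = 0.
Proof.
by rewrite /extend0; case: pselect => // e []; case: e => x xz; exists x.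
Qed.

Lemma extend0_ge b (e : R[i]) : 0 < e ->
  [set z | e <= `|extend0 b z|] = iota @` [set x | e <= `|b x|].
Proof.
move=> e0; apply/seteqP; split=> z /=; last first.
  by move=> [x ex <-]; rewrite extend0_in.
have [[x _ <-]|/extend0_out ->] := pselect (range iota z).
  by rewrite extend0_in => ex; exists x.
by rewrite normr0 => /(lt_le_trans e0); rewrite ltxx.
Qed.

Lemma extend0_vanishing b : vanishing b -> vanishing (extend0 b).
Proof.
move=> vb e e0; rewrite extend0_ge //; have [ci _ _] := oi.
by apply: continuous_compact; [exact: continuous_subspaceT|exact: vb].
Qed.

(** On the range, continuity transfers along the open map [iota]. Off it, the set where the
    extension is at least [e] in modulus is compact, hence closed in [Z], and its complement is a
    neighbourhood. *)
Lemma extend0_continuous b : continuous b -> vanishing b ->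
  continuous (extend0 b).
Proof.
move=> cb vb z; have [ci inj io] := oi.
have [[x _ <-]|nz] := pselect (range iota z).
  move=> O; rewrite extend0_in => /cb; rewrite nbhsE => -[U [oU Ux] UO].
  rewrite /nbhs /=; apply: (@filterS _ _ _ (iota @` U)).
    by move=> _ [y Uy <-] /=; rewrite extend0_in; exact: UO.
  by apply: open_nbhs_nbhs; split; [exact: io|exists x].
apply/(@cvgrPdist_lt R[i] C) => e e0; rewrite extend0_out //.
have : nbhs z (~` [set z | e <= `|extend0 b z|]).
  apply: open_nbhs_nbhs; split.
    apply: closed_openC; apply: compact_closed => //.
    by apply: extend0_vanishing.
  rewrite /= extend0_out // normr0 => /(lt_le_trans e0).
  by rewrite ltxx.
apply: filterS => w /= /negP; rewrite sub0r normrN -real_ltNge //.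
exact: gtr0_real.
Qed.

Definition C0_extend (b : C0 R X) : C0 R Z :=
  mkC0 (extend0_continuous (@C0_continuous R X b) (@C0_vanishing R X b))
    (extend0_vanishing (@C0_vanishing R X b)).

Lemma C0_extend_in b x : C0_extend b (iota x) = b x.
Proof. exact: extend0_in. Qed.

Lemma C0_extend_out b z : ~ range iota z -> C0_extend b z = 0.
Proof. exact: extend0_out. Qed.

Lemma open_inclusion_preimage_compact (K : set Z) : compact K ->
  K `<=` range iota -> compact (iota @^-1` K).
Proof.
move=> cK Ki F FF FK; have [ci inj io] := oi.
have [z [Kz Fz]] := cK (iota @ F) _ FK.
have [x _ xz] := Ki z Kz; exists x; split; first by rewrite /= xz.
move=> A B FA; rewrite nbhsE => -[U [oU Ux] UB].
have FiA : F (iota @^-1` (iota @` A)) by apply: filterS FA => a Aa; exists a.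
have zU : nbhs z (iota @` U).
  by apply: open_nbhs_nbhs; split; [exact: io|exists x].
have [_ [[a Aa <-] [u Uu]]] := Fz _ _ FiA zU.
by move=> /inj ua; exists a; split => //; apply: UB; rewrite -ua.
Qed.

(** A function vanishing off the range restricts to C_0(X) because its superlevel sets are compact
    subsets of the range. This pointwise description serves to check closedness, the ideal property
    and membership. *)
Lemma range_C0_extend :
  range C0_extend = [set c | forall z, ~ range iota z -> c z = 0].
Proof.
apply/seteqP; split=> [_ [b _ <-] z|c c0]; first exact: C0_extend_out.
have [ci _ _] := oi; have cc : continuous (c \o iota : X -> C).
  by move=> x; apply: continuous_comp; [exact: ci|exact: C0_continuous].
have vc : vanishing (c \o iota : X -> C).
  move=> e e0; apply: (@open_inclusion_preimage_compact [set z | e <= `|c z|]).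
    exact: C0_vanishing.
  move=> z /= ez; apply: contrapT => /c0 cz.
  by move: ez; rewrite cz normr0 => /(lt_le_trans e0); rewrite ltxx.
exists (mkC0 cc vc) => //; apply: C0_eqP => z.
have [[x _ <-]|nz] := pselect (range iota z); first by rewrite C0_extend_in.
by rewrite C0_extend_out ?c0.
Qed.

Lemma C0_eval_continuous (T : topologicalType) (z : T) :
  continuous (fun c : C0 R T => c z : C).
Proof.
move=> c; apply/(@cvgrPdist_lt R[i] C (C0 R T) (nbhs c) _) => e e0.
have : \forall d \near c, ball c e d by exact: nbhsx_ballx.
apply: filterS => d; rewrite -ball_normE /= => cd.
exact: (le_lt_trans (C0_norm_ub (c - d) z)).
Qed.

Lemma C0_extend_ideal : ideal_embedding C0_extend.
Proof.
split.
- split=> [k x y|x y|x]; apply: C0_eqP => z;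
    have [[t _ <-]|nz] := pselect (range iota z).
  + by rewrite [RHS](_ : _ = k * C0_extend x (iota t) + C0_extend y (iota t)) //
      !C0_extend_in.
  + by rewrite [RHS](_ : _ = k * C0_extend x z + C0_extend y z) //
      !C0_extend_out // mulr0 addr0.
  + by rewrite [RHS](_ : _ = C0_extend x (iota t) * C0_extend y (iota t)) //
      !C0_extend_in.
  + by rewrite [RHS](_ : _ = C0_extend x z * C0_extend y z) //
      !C0_extend_out // mulr0.
  + by rewrite [RHS](_ : _ = Num.conj (C0_extend x (iota t))) // !C0_extend_in.
  + by rewrite [RHS](_ : _ = Num.conj (C0_extend x z)) // !C0_extend_out // rmorph0.
- by move=> x y xy; apply: C0_eqP => t; rewrite -!C0_extend_in xy.
- rewrite range_C0_extend; split.
  + split=> // k x y x0 y0 z nz.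
    by rewrite [LHS](_ : _ = k * x z + y z) // x0 // y0 // mulr0 addr0.
  + rewrite [X in closed X](_ : _ = \bigcap_(z in ~` range iota)
        [set c : C0 R Z | `|c z| <= 0]); last first.
      apply/seteqP; split=> c c0 z nz; have := c0 z nz.
        by rewrite /= => ->; rewrite normr0.
      by rewrite /= normr_le0 => /eqP.
    apply: closed_bigI => z _; apply: closed_norm_le.
    exact: C0_eval_continuous.
  + move=> c x x0; split=> z nz.
      by rewrite [LHS](_ : _ = c z * x z) // x0 // mulr0.
    by rewrite [LHS](_ : _ = x z * c z) // x0 // mul0r.
Qed.

End extension_by_zero.

(** * (NF1) and (NF2) for the pullback to C_0(Z) *)

Section compactification_pullback.
Variables (R : realType) (X Y Z : topologicalType) (f : X -> Y) (g : Z -> Y).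
Hypotheses (hY : hausdorff_space Y) (lcY : locally_compact [set: Y]).
Hypothesis (cf : continuous f).
Local Notation C := (R[i]^o).
Local Notation Yp := (one_point_compactification Y).

(* [k] descends along the homeomorphism [g|S] to the part [g S] of the closed
   set [~` (Prp f `\` F)] of the one-point compactification, where it is
   completed by 0; Tietze's theorem applies there. *)
Lemma descend_extend (S : set Z) (F : set Y) (k : Z -> R) (M : R) :
  continuous g -> homeo_on S g -> g @` S `<=` Prp f -> closed F ->
  g @` S = F `&` Prp f ->
  continuous k -> (forall z, k z != 0 -> S z) -> (forall z, `|k z| <= M) ->
  (forall e : R, 0 < e -> compact [set z | e <= `|k z|]) ->
  exists h : Yp -> R, [/\ continuous h, h None = 0,
    forall y, ~ Prp f y -> h (Some y) = 0 & forall z, S z -> h (Some (g z)) = k z].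
Proof.
move=> cg [ginj _ gopen] gSP clF gSF ck kS kM kc.
pose A : set Yp := ~` (Some @` (Prp f `\` F)).
have clA : closed A.
  apply: open_closedC; apply: one_point_compactification_open_some.
  by rewrite setDE; apply: openI; [exact: Prp_open|exact: closed_openC].
pose h0 (p : Yp) : R :=
  if pselect (exists z, S z /\ Some (g z) = p) is left e
  then k (sval (cid e)) else 0.
have h0g z : S z -> h0 (Some (g z)) = k z.
  move=> Sz; rewrite /h0; case: pselect => [e|]; last by case; exists z.
  have [Sw [gwz]] := svalP (cid e).
  by congr k; apply: ginj => //; rewrite inE.
have h0N p : h0 p != 0 -> exists z, [/\ S z, Some (g z) = p & h0 p = k z].
  rewrite /h0; case: pselect => [e|]; last by rewrite eqxx.
  by have [Sz gz] := svalP (cid e) => _; exists (sval (cid e)).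
have h0c : {within A, continuous h0}.
  apply/subspace_continuousP => p Ap; apply/cvgrPdist_lt => e e0.
  suff : \forall q \near within A (nbhs p), `|h0 p - h0 q| < e by [].
  (* If [h0 p] is 0, a neighbourhood of [p] avoids the closed image of the compact set where |k| >=
     e. Otherwise relative openness of [g] on [S] gives [V], cut down to [Prp f] so that its points
     in [A] lie in the image of [S]. *)
  have [hp0|/h0N[z [Sz zp hpk]]] := eqVneq (h0 p) 0.
    rewrite hp0.
    have : nbhs p (~` (Some @` (g @` [set z | e <= `|k z|]))).
      apply: open_nbhs_nbhs; split.
        apply: closed_openC; apply: compact_Some_closed => //.
        by apply: continuous_compact; [exact: continuous_subspaceT|exact: kc].
      move=> [_ [z /= ez <-] zp]; move: (ez); rewrite leNgt -h0g.
        by rewrite zp hp0 normr0 e0.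
      by apply: kS; rewrite -normr_gt0 (lt_le_trans e0).
    rewrite /within /=; apply: filterS => q nq Aq; rewrite sub0r normrN ltNge.
    apply/negP => eq; apply: nq.
    have /h0N[z [Sz zq hq]] : h0 q != 0 by rewrite -normr_gt0 (lt_le_trans e0).
    by exists (g z) => //; exists z => //=; rewrite -hq.
  rewrite hpk -zp.
  have oU : open [set w | `|k z - k w| < e].
    rewrite (_ : mkset _ = k @^-1` ball (k z) e).
      by apply: open_comp; [move=> w _; exact: ck|exact: ball_open].
    by rewrite -ball_normE.
  have [V oV gU] := gopen _ oU.
  have : nbhs (Some (g z) : Yp) (Some @` (V `&` Prp f)).
    apply: open_nbhs_nbhs; split.
      apply: one_point_compactification_open_some.
      by apply: openI => //; exact: Prp_open.
    exists (g z) => //; split; last by apply: gSP; exists z.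
    have : (g @` ([set w | `|k z - k w| < e] `&` S)) (g z).
      by exists z => //; split => //=; rewrite subrr normr0.
    by rewrite gU => -[].
  rewrite /within /=; apply: filterS => _ [y [Vy Py] <-] Ay.
  have Fy : F y by apply: contrapT => nFy; apply: Ay; exists y.
  have : (V `&` g @` S) y by rewrite gSF.
  by rewrite -gU => -[w [/= kzw Sw] <-]; rewrite h0g.
have M1 : 0 < `|M| + 1 by rewrite ltr_wpDl.
have h0M p : A p -> `|h0 p| <= `|M| + 1.
  move=> _; have [->|/h0N[z [_ _ ->]]] := eqVneq (h0 p) 0.
    by rewrite normr0 ltW.
  by rewrite (le_trans (kM z)) // (le_trans (ler_norm _)) // lerDl.
have nYp := one_point_compactification_normal hY lcY.
have [h [h0h ch _]] := continuous_bounded_extension nYp clA M1 h0c h0M.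
have out y : ~ (F `&` Prp f) y -> h0 (Some y) = 0.
  move=> nFy; apply/eqP/negPn/negP => /h0N[z [Sz [zy] _]]; apply: nFy.
  by rewrite -gSF -zy; exists z.
exists h; split => //.
- rewrite -h0h; last by rewrite inE => -[y _].
  by apply/eqP/negPn/negP => /h0N[z []].
- move=> y nPy; rewrite -h0h; first by apply: out => -[].
  by rewrite inE => -[y' [Py' _] [yy]]; apply: nPy; rewrite -yy.
- move=> z Sz; rewrite -h0h ?h0g // inE => -[y [_ nFy] [yz]]; apply: nFy.
  have : (g @` S) (g z) by exists z.
  by rewrite gSF yz => -[].
Qed.

Hypotheses (hX : hausdorff_space X) (lcX : locally_compact [set: X]).
Hypothesis fg : fibrewise_compactification f g.

(** Real and imaginary parts are lifted separately, Tietze's theorem being real-valued. The lift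
    vanishes off [Prp f], so its superlevel sets are compact inside [Prp f] and have compact
    preimages in [X]. Boundary points of [X] lie over the complement of [Prp f], where both sides
    are 0. *)
Lemma fibrewise_compactification_lift (iota : X -> Z)
    (S := ~` closure (range iota)) (F : set Y) (c : C0 R Z) :
  open_inclusion iota -> g \o iota = f -> homeo_on S g -> g @` S `<=` Prp f ->
  closed F -> g @` S = F `&` Prp f ->
  (forall x, c (iota x) = 0) ->
  exists2 a : C0 R Y, vanishing (a \o f : X -> C) &
    forall z, ~ range iota z -> a (g z) = c z.
Proof.
move=> oi gi hS gSP clF gSF c0; have [ci _ _] := oi.
have cg := fc_continuous fg.
have cS z : c z != 0 -> S z.
  move=> cz; rewrite /S /= => clz; move/negP : cz; apply.
  have : closure [set w | `|c w| <= 0] z.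
    apply: closureS clz => _ [x _ <-] /=.
    by rewrite c0 normr0.
  have /closure_id <- : closed [set w | `|c w| <= 0].
    by apply: closed_norm_le; exact: C0_continuous.
  by rewrite /= normr_le0.
pose M := complex.Re (C0_norm c).
have cM z : complex.Re `|c z| <= M.
  by rewrite -lecR Re_norm; exact: (C0_norm_ub c z).
have part (p : C -> R) : (continuous (p \o c : Z -> R)) ->
    (forall z, `|p z|%:C%C <= `|z|) ->
    exists h : Yp -> R, [/\ continuous h, h None = 0,
      forall y, ~ Prp f y -> h (Some y) = 0 &
      forall z, S z -> h (Some (g z)) = p (c z)].
  move=> pc pz; apply: (descend_extend (M := M) cg hS gSP clF gSF pc).
  - move=> z /= pcz; apply: cS; rewrite -normr_gt0.
    by rewrite (lt_le_trans _ (pz _)) // ltcR normr_gt0.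
  - by move=> z; rewrite (le_trans _ (cM z)) // -lecR Re_norm; exact: pz.
  - move=> e e0; have eC : (0 : R[i]) < e%:C%C by rewrite ltcR.
    apply: (subclosed_compact _ (C0_vanishing (f := c) eC)).
      rewrite (_ : mkset _ = (fun z => `|p (c z)|) @^-1` [set r | e <= r]) //.
      apply: closed_comp; last exact: closed_ge.
      by move=> z _; apply: cvg_norm; exact: pc.
    by move=> z /= ez; rewrite (le_trans _ (pz _)) // lecR.
have [h1 [ch1 h1N h1P h1g]] := part (@complex.Re R)
  (Re_continuous (@C0_continuous R Z c)) (@ler_Re_norm R).
have [h2 [ch2 h2N h2P h2g]] := part (@complex.Im R)
  (Im_continuous (@C0_continuous R Z c)) (@ler_Im_norm R).
pose h p : C := (h1 p +i* h2 p)%C.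
have ch : continuous h by exact: continuous_complex.
have hN : h None = 0 by rewrite /h h1N h2N.
exists (mkC0 (comp_Some_continuous ch) (vanishing_Some ch hN)).
  move=> e e0; apply: (@preimage_Prp_compact X Y f [set y | e <= `|h (Some y)|]).
  - exact: hY.
  - exact: cf.
  - exact: (vanishing_Some ch hN e0).
  - move=> y /= ey; apply: contrapT => nPy; move: ey.
    rewrite /h h1P // h2P // (_ : (0 +i* 0)%C = 0) // normr0.
    by move=> /(lt_le_trans e0); rewrite ltxx.
move=> z niz; rewrite [LHS](_ : _ = h (Some (g z))) //.
have [Sz|nSz] := pselect (S z).
  by rewrite /h h1g // h2g //; case: (c z).
have nP : ~ Prp f (g z).
  move=> Pz; apply: niz; apply: (closure_over_Prp (fc_hausdorff fg) cg ci) Pz.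
    by move=> x; rewrite -gi.
  exact: contrapT.
rewrite /h h1P // h2P //; apply/esym/eqP/negPn/negP => /cS; exact.
Qed.

Lemma compactification_nc : nc_fibrewise_compactification (pullback (R := R) cf)
  (proper_pullback (R := R) (fc_continuous fg) (fc_proper fg)).
Proof.
split; first exact: proper_pullback_Morp.
have [iota [oi gi hS gSP [F clF gSF]]] := fc_inclusion fg.
have hZ := fc_hausdorff fg.
pose E : C0 R X -> C0 R Z := C0_extend hZ oi.
have EP : ideal_embedding E by exact: C0_extend_ideal.
have Einj : injective E by case: EP.
exists E, EP; split.
  apply/funext => a; apply: mult_eqP => b; apply: Einj.
  rewrite [LHS]iota_induced_l; apply: C0_eqP => z.
  have [[x _ <-]|nz] := pselect (range iota z).
    rewrite [LHS](_ : _ = a (g (iota x)) * E b (iota x)) // !C0_extend_in.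
    by rewrite -[g (iota x)]/((g \o iota) x) gi.
  by rewrite [LHS](_ : _ = a (g z) * E b z) // !C0_extend_out // mulr0.
move=> _ [c cann <-].
have c0 x : c (iota x) = 0.
  have [b [_ b1 _]] := C0_bump R hX lcX openT (I : [set: X] x).
  have /(congr1 (fun h : C0 R Z => h (iota x))) :=
    cann (E b) (ex_intro2 _ _ b I erefl).
  by rewrite [LHS](_ : _ = c (iota x) * E b (iota x)) // C0_extend_in b1 mulr1.
have [a va ac] := fibrewise_compactification_lift oi gi hS gSP clF gSF c0.
exists a.
  exists (mkC0 (comp_C_continuous cf (a := a)) va) => //.
  by apply: mult_eqP => b; apply: C0_eqP.
set pa := proper_pullback _ _ a.
(* The difference vanishes off [X], hence comes from some [d] in C_0(X); translation by [d] matches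
   the two cosets. *)
have [d _ dE] : range E (pa - c).
  rewrite range_C0_extend => z nz.
  by rewrite [LHS](_ : _ = a (g z) - c z) // ac // subrr.
apply/seteqP; split=> _ [e [b _ <-] <-].
  exists (E (d + b)); first by exists (d + b).
  by have [[El _ _] _ _] := EP; rewrite -[d]scale1r El scale1r dE addrA subrKC.
exists (E (- d + b)); first by exists (- d + b).
have [[El _ _] _ _] := EP; rewrite -scaleN1r El scaleN1r dE.
by rewrite addrA subKr.
Qed.

End compactification_pullback.

(** * Characters and square roots in Banach algebras *)

Section limits.
Variables (R : realType) (V : completeNormedModType R[i]).
Implicit Types (x : nat -> V) (e : nat -> R).

Lemma gt0_RReK (r : R[i]) : 0 < r -> r = (complex.Re r)%:C%C /\ 0 < complex.Re r.
Proof. by case: r => a b; rewrite ltcE /= => /andP[/eqP -> a0]. Qed.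

Lemma ge0_RReK (r : R[i]) : 0 <= r -> r = (complex.Re r)%:C%C.
Proof. by case: r => a b; rewrite lecE /= => /andP[/eqP ->]. Qed.

Lemma telescope_norm x e m n : (m <= n)%N ->
  (forall k, `|x k.+1 - x k| <= (e k.+1 - e k)%:C%C) ->
  `|x n - x m| <= (e n - e m)%:C%C.
Proof.
move=> mn xe; elim: n mn => [|n IH].
  by rewrite leqn0 => /eqP ->; rewrite !subrr normr0.
rewrite leq_eqVlt => /predU1P[->|]; first by rewrite !subrr normr0.
rewrite ltnS => /IH {}IH; rewrite -(subrKA (x n)) (le_trans (ler_normD _ _)) //.
by rewrite -(subrKA (e n)) rmorphD /= lerD.
Qed.

(** The majorant [e] is nondecreasing and bounded, hence convergent, and its Cauchy property passes
    to [x]. Both the Neumann series and the square root iteration use this criterion. *)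
Lemma telescope_cvg x e (M : R) :
  (forall k, `|x k.+1 - x k| <= (e k.+1 - e k)%:C%C) ->
  (forall k, e k <= M) -> cvg (x @ \oo).
Proof.
move=> xe eM; have ndec : nondecreasing_seq e.
  by apply/nondecreasing_seqP => k; rewrite -subr_ge0 -ler0c (le_trans _ (xe k)).
have ec : cvgn e.
  by apply: nondecreasing_is_cvgn => //; exists M => _ [k _ <-].
apply: cauchy_cvg; apply: cauchy_exP => r /gt0_RReK[-> r0].
have /cvgrPdist_lt/(_ _ r0)[N _ HN] := ec.
exists (x N), N => // n /= Nn; rewrite -ball_normE /= distrC.
apply: (le_lt_trans (telescope_norm Nn xe)); rewrite ltcR.
apply: le_lt_trans (HN N (leqnn N)); apply: le_trans (ler_norm _).
by rewrite lerD2r; exact: nondecreasing_cvgn_le.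
Qed.

End limits.

Section algebra_limits.
Variables (R : realType) (C : cstarType R).
Implicit Types (u v : nat -> C) (x y : C).

Lemma cvg_amull x u y : u @ \oo --> y -> (fun n => x ** u n) @ \oo --> x ** y.
Proof.
move=> uy; apply/cvgrPdist_lt => e e0.
have e1 : 0 < e / (`|x| + 1) by rewrite divr_gt0 // ltr_wpDl.
move/cvgrPdist_lt : uy => /(_ _ e1); apply: filterS => n yn.
rewrite -amulBr (le_lt_trans (norm_amul_le _ _)) //.
rewrite (@le_lt_trans _ _ ((`|x| + 1) * `|y - u n|)) //.
  by rewrite ler_wpM2r // lerDl.
by rewrite mulrC -ltr_pdivlMr // ltr_wpDl.
Qed.

Lemma norm_star x : `|star x| = `|x|.
Proof.
have le y : `|y| <= `|star y|.
  have [->|y0] := eqVneq y 0; first by rewrite normr0.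
  have := norm_amul_le (star y) y; rewrite cstar_identity expr2.
  by rewrite ler_pM2r // normr_gt0.
by apply/eqP; rewrite eq_le le andbT -[X in _ <= `|X|]starK le.
Qed.

Lemma starB x y : star (x - y) = star x - star y.
Proof. by rewrite starD -scaleN1r starZ rmorphN1 scaleN1r. Qed.

Lemma cvg_star u y : u @ \oo --> y -> (fun n => star (u n)) @ \oo --> star y.
Proof.
move=> uy; apply/cvgrPdist_lt => e e0.
move/cvgrPdist_lt : uy => /(_ _ e0); apply: filterS => n yn.
by rewrite -starB norm_star.
Qed.

Lemma cvg_amulr x u y : u @ \oo --> y -> (fun n => u n ** x) @ \oo --> y ** x.
Proof.
move=> /cvg_star /(@cvg_amull (star x)) /cvg_star; rewrite starM !starK.
by under eq_fun do rewrite starM !starK.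
Qed.

Lemma char0 (chi : character C) : chi 0 = 0.
Proof. by have := charZ chi 0 0; rewrite scale0r mul0r. Qed.

Lemma charN (chi : character C) x : chi (- x) = - chi x.
Proof. by rewrite -scaleN1r charZ mulN1r. Qed.

Lemma charB (chi : character C) x y : chi (x - y) = chi x - chi y.
Proof. by rewrite charD charN. Qed.

Lemma char_eq1 (chi : character C) : exists x, chi x = 1.
Proof.
have [x x0] := char_neq0 chi; exists ((chi x)^-1 *: x).
by rewrite charZ mulVf.
Qed.

(* If [|x| < 1] and [chi x = 1], the Neumann series solves [y = x + x y],
   which [chi] maps to [chi y = 1 + chi y]. *)
Lemma char_norm_le (chi : character C) x : `|chi x| <= `|x|.
Proof.
rewrite real_leNgt ?normr_real //; apply/negP => chix.
have cx0 : chi x != 0 by rewrite -normr_gt0 (le_lt_trans _ chix).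
pose z := (chi x)^-1 *: x.
have z1 : chi z = 1 by rewrite charZ mulVf.
pose r := complex.Re `|z|.
have rE : `|z| = r%:C%C by exact: ge0_RReK.
have r0 : 0 <= r by rewrite -ler0c -rE.
have r1 : r < 1.
  rewrite -ltcR -rE normrZ normfV ltr_pdivrMl ?normr_gt0 //.
  by rewrite mulr1.
pose y := fix F n := if n is n.+1 then z + z ** F n else 0 : C.
(* A discrete primitive of the geometric sequence, [e n.+1 - e n = r ^+ n], that is bounded above by
   0. *)
pose e n : R := - r ^+ n / (1 - r).
have r10 : 1 - r != 0 by rewrite gt_eqF // subr_gt0.
have eE n : e n.+1 - e n = r ^+ n.
  rewrite /e exprS -mulrBl opprK addrC -{1}[r ^+ n]mul1r -mulrBl mulrAC.
  by rewrite divff ?mul1r.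
have ye n : `|y n.+1 - y n| <= (e n.+1 - e n)%:C%C.
  rewrite eE; elim: n => [|n IH] /=.
    by rewrite amul0r addr0 subr0 rE lecR expr0 ltW.
  rewrite opprD addrACA subrr add0r -amulBr (le_trans (norm_amul_le _ _)) //.
  by rewrite exprS rmorphM /= -rE ler_wpM2l.
have /cvg_ex[/= l yl] : cvg (y @ \oo).
  apply: (telescope_cvg (M := 0) ye) => n.
  rewrite /e mulNr oppr_le0 divr_ge0 ?exprn_ge0 // subr_ge0 ltW //.
have yl1 : (fun n => y n.+1) @ \oo --> z + z ** l.
  by apply: cvgD; [exact: cvg_cst|exact: cvg_amull].
have yl2 : (fun n => y n.+1) @ \oo --> l by rewrite (cvg_shiftS y).
have yE : l = z + z ** l by exact: norm_cvg_unique yl2 yl1.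
have := congr1 chi yE; rewrite charD charM z1 mul1r -{1}[chi l]add0r.
by move=> /addIr/eqP; rewrite eq_sym oner_eq0.
Qed.

End algebra_limits.

(** * Square roots and negative parts of multipliers *)

Section commutative_multipliers.
Variables (R : realType) (C : cstarType R).
Hypothesis hC : forall x y : C, x ** y = y ** x.
Implicit Types (T S : multiplier C) (x y : C).

Lemma lmultM T x y : T (x ** y) = T x ** y.
Proof. by apply: amul_injl => z; rewrite multP !amulA multP. Qed.

Lemma mult_swap T x y : x ** T y = T x ** y.
Proof. by rewrite -lmultM hC -lmultM hC. Qed.

Lemma mult_comm S T x : S (T x) = T (S x).
Proof.
apply: amul_injr => y.
by rewrite -mult_swap -lmultM mult_swap lmultM -mult_swap.
Qed.

(** With [star x ** y] viewed as a [C]-valued inner product, [star T] is the adjoint of [T];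
    self-adjointness and isometry are tested this way. *)
Lemma mult_adjoint T x y : star x ** (star T : multiplier C) y = star (T x) ** y.
Proof. by have := multP (star T) (star x) y; rewrite /= starK. Qed.

Definition mult_id : multiplier C := @Multiplier R C id id (fun x y => erefl).

Lemma mult_sa T : (forall x y, star x ** T y = star (T x) ** y) -> star T = T.
Proof.
move=> sT; apply: mult_eqP => y; apply: amul_injl => z.
by rewrite -[z]starK sT mult_adjoint.
Qed.

Definition contraction T := forall x, `|T x| <= `|x|.

Lemma isometry_mult T : (forall x, (star T : multiplier C) (T x) = x) ->
  forall x, `|T x| = `|x|.
Proof.
move=> uT x; apply/eqP; rewrite -(@eqrXn2 _ 2) //; apply/eqP.
by rewrite -!cstar_identity -mult_adjoint uT.
Qed.

Fixpoint sqrt_bound n : R :=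
  if n is n.+1 then 2^-1 * (1 + sqrt_bound n ^+ 2) else 0.

Lemma sqrt_bound_ge0 n : 0 <= sqrt_bound n.
Proof. by case: n => //= n; rewrite mulr_ge0 ?invr_ge0 // addr_ge0 ?sqr_ge0. Qed.

Lemma sqrt_bound_le1 n : sqrt_bound n <= 1.
Proof.
elim: n => //= n IH; rewrite ler_pdivrMl // mulr1 lerD2l.
by rewrite expr_le1 // sqrt_bound_ge0.
Qed.

(* Iteration of [q = (S + q^2) / 2] for [q = 1 - sqrt (1 - S)]; it has
   nonnegative coefficients, so its increments are bounded by those for
   [S = 1]. *)
Fixpoint sqrt_iter S n : multiplier C :=
  if n is n.+1 then (2^-1 : R[i]) *: (S + sqrt_iter S n ** sqrt_iter S n) else 0.

Lemma sqrt_iterS S n x : sqrt_iter S n.+1 x =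
  (2^-1 : R[i]) *: (S x + sqrt_iter S n (sqrt_iter S n x)).
Proof. by []. Qed.

Lemma half_C : (2^-1 : R[i]) = (2^-1 : R)%:C%C.
Proof. by rewrite fmorphV rmorph_nat. Qed.

Lemma sqrt_iter_le S n x : contraction S ->
  `|sqrt_iter S n x| <= (sqrt_bound n)%:C%C * `|x|.
Proof.
move=> cS; elim: n x => [|n IH] x; first by rewrite normr0 mul0r.
rewrite sqrt_iterS normrZ ger0_norm ?invr_ge0 // /= half_C rmorphM /= -mulrA.
rewrite ler_wpM2l ?ler0c ?invr_ge0 // rmorphD /= mulrDl mul1r.
rewrite (le_trans (ler_normD _ _)) // lerD //.
rewrite (le_trans (IH _)) // rmorphXn /= expr2 -mulrA ler_wpM2l ?IH //.
by rewrite ler0c sqrt_bound_ge0.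
Qed.

Lemma sqrt_iter_contr S n : contraction S -> contraction (sqrt_iter S n).
Proof.
move=> cS x; rewrite (le_trans (sqrt_iter_le _ _ cS)) // ler_piMl //.
by rewrite (_ : 1 = 1%:C%C) // lecR sqrt_bound_le1.
Qed.

Lemma multB_app S T x : (S - T) x = S x - T x.
Proof. by rewrite -scaleN1r /= scaleN1r. Qed.

Lemma lmultB T x y : T (x - y) = T x - T y.
Proof. by rewrite lmultD -scaleN1r lmultZ scaleN1r. Qed.

(** Successive iterates commute, so the next increment is half the product of their sum and their
    difference. The scalar bound factors in the same way, and the estimates multiply. *)
Lemma sqrt_iter_incr S n x : contraction S ->
  `|sqrt_iter S n.+1 x - sqrt_iter S n x| <=
    (sqrt_bound n.+1 - sqrt_bound n)%:C%C * `|x|.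
Proof.
move=> cS; elim: n x => [|n IH] x.
  by rewrite subr0 [leRHS](_ : _ = (sqrt_bound 1)%:C%C * `|x|) ?sqrt_iter_le ?subr0.
set Q := sqrt_iter S; set q := sqrt_bound.
have QQ : Q n.+2 x - Q n.+1 x =
    (2^-1 : R[i]) *: (Q n.+1 (Q n.+1 x - Q n x) + Q n (Q n.+1 x - Q n x)).
  rewrite [Q n.+2]/Q sqrt_iterS -/Q [X in _ - X]sqrt_iterS -/Q -scalerBr.
  rewrite opprD addrACA subrr add0r !lmultB (mult_comm (Q n) (Q n.+1)).
  by rewrite addrA subrK.
have qq : q n.+2 - q n.+1 = 2^-1 * ((q n.+1 + q n) * (q n.+1 - q n)).
  rewrite [X in _ * X]mulrC -subr_sqr [q n.+2]/(2^-1 * (1 + q n.+1 ^+ 2)).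
  by rewrite [X in _ - X]/(2^-1 * (1 + q n ^+ 2)) -mulrBr opprD addrACA subrr add0r.
have QL k y : `|Q k y| <= (q k)%:C%C * `|y| by exact: sqrt_iter_le.
have {}IH y : `|Q n.+1 y - Q n y| <= (q n.+1 - q n)%:C%C * `|y| by exact: IH.
have q0 k : 0 <= q k by exact: sqrt_bound_ge0.
rewrite QQ qq; clearbody Q q; clear QQ qq.
rewrite normrZ ger0_norm ?invr_ge0 // half_C rmorphM /= -mulrA.
rewrite ler_wpM2l ?ler0c ?invr_ge0 // (le_trans (ler_normD _ _)) //.
rewrite rmorphM rmorphD /= -mulrA mulrDl.
by apply: lerD; apply: le_trans (QL _ _) _; rewrite ler_wpM2l ?ler0c ?q0.
Qed.

Lemma sqrt_iter_cvg S x : contraction S ->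
  cvg ((fun n => sqrt_iter S n x) @ \oo).
Proof.
move=> cS; pose k := complex.Re `|x|.
have kE : `|x| = k%:C%C by exact: ge0_RReK.
apply: (telescope_cvg (e := fun n => sqrt_bound n * k) (M := k)) => n.
  by rewrite -mulrBl rmorphM /= -kE; exact: sqrt_iter_incr.
by rewrite ler_piMl ?sqrt_bound_le1 // -ler0c -kE.
Qed.

Lemma sqrt_lim_swap S (cS : contraction S) x y :
  x ** lim ((fun n => sqrt_iter S n y) @ \oo) =
  lim ((fun n => sqrt_iter S n x) @ \oo) ** y.
Proof.
have /(@cvg_amull _ _ x) c1 := sqrt_iter_cvg (x := y) cS.
have /(@cvg_amulr _ _ y) c2 := sqrt_iter_cvg (x := x) cS.
apply: norm_cvg_unique c1 _; move: c2.
by under eq_fun do rewrite -mult_swap.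
Qed.

(** The pointwise limit satisfies Q = (S + Q^2) / 2. Rearranged, this is (1 - Q)^2 = 1 - S, the
    middle clause, so 1 - Q acts as the square root of 1 - S. *)
Lemma mult_sqrt S : contraction S -> exists Q : multiplier C,
  [/\ contraction Q, forall x, x - Q x - Q (x - Q x) = x - S x &
    star S = S -> star Q = Q].
Proof.
move=> cS; pose Q := Multiplier (sqrt_lim_swap cS); exists Q.
have QC x : (fun n => sqrt_iter S n x) @ \oo --> Q x by exact: sqrt_iter_cvg.
have cQ : contraction Q.
  move=> x; apply/ler_addgt0Pr => e e0.
  have /cvgrPdist_lt/(_ _ e0)/filter_ex[n Qn] := QC x.
  rewrite -(subrK (sqrt_iter S n x) (Q x)) (le_trans (ler_normD _ _)) //.
  by rewrite addrC lerD ?(ltW Qn) // sqrt_iter_contr.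
split => //.
  move=> x; have QQ : (fun n => sqrt_iter S n (sqrt_iter S n x)) @ \oo --> Q (Q x).
    apply/cvgrPdist_lt => e e0; have e20 : 0 < e / 2 by rewrite divr_gt0.
    have /cvgrPdist_lt/(_ _ e20) := QC x.
    have /cvgrPdist_lt/(_ _ e20) := QC (Q x).
    apply: filterS2 => n Q1 Q2; rewrite -(subrKA (sqrt_iter S n (Q x))).
    rewrite (le_lt_trans (ler_normD _ _)) // [ltRHS]splitr ltrD //.
    by rewrite -lmultB (le_lt_trans (sqrt_iter_contr _ cS _)).
  have Q1 : (fun n => sqrt_iter S n.+1 x) @ \oo --> Q x.
    by rewrite (cvg_shiftS (fun n => sqrt_iter S n x)).
  have Q2 : (fun n => sqrt_iter S n.+1 x) @ \oo -->
      (2^-1 : R[i]) *: (S x + Q (Q x)).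
    by apply: cvgZr; apply: cvgD QQ; exact: cvg_cst.
  have QE : Q x = (2^-1 : R[i]) *: (S x + Q (Q x)) by exact: norm_cvg_unique Q1 Q2.
  have E : Q x + Q x = S x + Q (Q x).
    by rewrite -mulr2n -scaler_nat {1}QE scalerA divff ?pnatr_eq0 ?scale1r.
  have -> : S x = Q x + Q x - Q (Q x) by rewrite E addrK.
  by rewrite lmultB -addrA -opprD addrA.
move=> sS; have sQ n : star (sqrt_iter S n) = sqrt_iter S n.
  elim: n => [|n IH] /=; first by rewrite -(scale0r 0) starZ conjC0 !scale0r.
  by rewrite starZ starD starM sS IH conj_Creal // rpredV realn.
apply: mult_sa => x y.
apply: norm_cvg_unique (@cvg_amull _ _ (star x) _ _ (QC y)) _.
have := @cvg_amulr _ _ y _ _ (cvg_star (QC x)).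
by under eq_fun do rewrite -mult_adjoint sQ.
Qed.

(** The first root gives a self-adjoint [b] with b^2 = 1 - T^2. A second root, of 1 - b^2 = T^2,
    requires [b] to be a contraction, which holds because 2 i b is the difference of the isometries
    T + i b and T - i b. The result, playing |T|, is written 1 - Q. *)
Lemma mult_abs T : star T = T -> contraction T -> exists Q : multiplier C,
  contraction Q /\ forall x, x - Q x - Q (x - Q x) = T (T x).
Proof.
move=> sT cT; have cTT : contraction (T ** T).
  by move=> x; rewrite (le_trans (cT _)).
have [Q1 [_ Q1E /(_ _) sQ1]] := mult_sqrt cTT.
have {}sQ1 : star Q1 = Q1 by apply: sQ1; rewrite starM sT.
pose b := mult_id - Q1.
have bE x : b x = x - Q1 x by rewrite multB_app.
have bb x : b (b x) = x - T (T x) by rewrite !bE Q1E.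
have sb : star b = b.
  apply: mult_sa => x y; rewrite !bE amulBr starB amulBl -mult_adjoint sQ1.
  by [].
pose u := T + 'i *: b; pose u' := T - 'i *: b.
have uE x : u x = T x + 'i *: b x by [].
have u'E x : u' x = T x - 'i *: b x by rewrite multB_app.
have su : star u = u'.
  by rewrite /u starD starZ sT sb conjCi scaleNr.
have su' : star u' = u by rewrite -su starK.
have uu x : u' (u x) = x.
  have e1 : T (u x) = T (T x) + 'i *: T (b x) by rewrite uE lmultD lmultZ.
  have e2 : 'i *: b (u x) = 'i *: T (b x) - b (b x).
    rewrite uE lmultD lmultZ (mult_comm b T) scalerDr scalerA -expr2 sqrCi.
    by rewrite scaleN1r.
  by rewrite u'E e1 e2 opprB addrA [_ + b _]addrC addrA addrK bb subrK.
have uu' x : u (u' x) = x by rewrite mult_comm.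
have Nu x : `|u x| = `|x| by apply: isometry_mult => y; rewrite su uu.
have Nu' x : `|u' x| = `|x| by apply: isometry_mult => y; rewrite su' uu'.
have cb : contraction b.
  move=> x; have : (2 * 'i : R[i]) *: b x = u x - u' x.
    rewrite uE u'E opprB addrC addrA subrK -scalerDl.
    by rewrite -mulr2n mulr_natl.
  move=> /(congr1 (fun v : C => `|v|)); rewrite normrZ normrM normCi mulr1 => nb.
  have : 2 * `|b x| <= 2 * `|x|.
    rewrite -[X in X * `|b x|](ger0_norm (ler0n _ 2)) nb mulr_natl mulr2n.
    by rewrite (le_trans (ler_normB _ _)) // Nu Nu'.
  by rewrite ler_pM2l.
have cbb : contraction (b ** b) by move=> x; rewrite (le_trans (cb _)).
have [Q2 [cQ2 Q2E _]] := mult_sqrt cbb.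
exists Q2; split => // x; rewrite Q2E (_ : (b ** b : multiplier C) x = x - T (T x)).
  by rewrite opprB addrC subrK.
exact: bb.
Qed.

(** Lets [chi] act on multipliers by sending [T] to [chi (T u)], whatever [u] with [chi u = 1] is
    chosen. *)
Lemma char_mult (chi : character C) T u x : chi u = 1 ->
  chi (T x) = chi (T u) * chi x.
Proof. by move=> u1; rewrite -[LHS]mulr1 -u1 -!charM hC mult_swap. Qed.

(** A direct use of [char_norm_le] gives only the bound |u|, which may exceed 1. Used on the
    iterates of [T] at [u], it bounds every power of [chi (T u)] by |u|, which forces modulus at
    most 1. *)
Lemma char_contraction (chi : character C) T u : contraction T -> chi u = 1 ->
  `|chi (T u)| <= 1.
Proof.
move=> cT u1; set m := chi (T u).
have pw n : `|m| ^+ n <= `|u|.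
  have [x xu chix] : exists2 x, `|x| <= `|u| & chi x = m ^+ n.
    elim: n => [|n [x xu xn]]; first by exists u.
    exists (T x); first by rewrite (le_trans (cT x)).
    by rewrite (char_mult _ _ u1) xn exprS.
  by rewrite -normrX -chix (le_trans (char_norm_le _ _)).
have mE : `|m| = (complex.Re `|m|)%:C%C by exact: ge0_RReK.
have uE : `|u| = (complex.Re `|u|)%:C%C by exact: ge0_RReK.
move: pw; rewrite mE uE (_ : 1 = 1%:C%C) // lecR.
set r := complex.Re `|m|; set M := complex.Re `|u| => pw.
rewrite leNgt; apply/negP => r1.
have r0 : 0 < r by rewrite (lt_trans ltr01).
have : `|r^-1| < 1 by rewrite ger0_norm ?invr_ge0 ?ltW // invf_lt1.
move=> /cvg_expr /cvgrPdist_lt /(_ (`|M| + 1)^-1).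
have M0 : 0 < `|M| + 1 by rewrite ltr_wpDl.
rewrite invr_gt0 => /(_ M0)/filter_ex[n]; rewrite sub0r normrN.
rewrite ger0_norm ?exprn_ge0 ?invr_ge0 ?ltW // exprVn ltf_pV2 ?posrE ?exprn_gt0 //.
apply/negP; rewrite -leNgt; have := pw n; rewrite -rmorphXn lecR => /le_trans; apply.
by rewrite (le_trans (ler_norm M)) // lerDl.
Qed.

(* If [chi u = 1], then [k = |T| u - T u] has [chi k = |t| - t], where
   [t = chi (T u)]: it vanishes iff [t >= 0]. *)
Lemma char_negative_part T : star T = T -> contraction T ->
  exists N : multiplier C, forall (chi : character C) u, chi u = 1 ->
    (chi (T u) >= 0 -> chi (N u) = 0) /\ (chi (T u) < 0 -> chi (N u) != 0).
Proof.
move=> sT cT; have [Q [cQ QE]] := mult_abs sT cT.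
exists (mult_id - Q - T) => chi u u1.
set t := chi (T u); pose q := chi (Q u).
have NE : chi ((mult_id - Q - T) u) = 1 - q - t.
  by rewrite !multB_app !charB u1.
have q1 : `|q| <= 1 by exact: char_contraction cQ u1.
have : (1 - q) ^+ 2 = t ^+ 2.
  have := congr1 chi (QE u); rewrite charB (char_mult Q _ u1) charB u1 -/q.
  by rewrite (char_mult T _ u1) -/t -expr2 => <-; ring.
(* The equation leaves two signs for [1 - q]; for real nonzero [t] the bound |q| <= 1 excludes the
   wrong one. *)
move/eqP; rewrite eqf_sqr NE => /orP[]/eqP qt; rewrite qt.
  have qE : q = 1 - t by rewrite -qt subKr.
  split=> [_|t0]; first by rewrite subrr.
  have q0 : 0 <= q by rewrite qE subr_ge0 (le_trans (ltW t0)).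
  by move: q1; rewrite ger0_norm // qE gerDl oppr_le0 (lt_geF t0).
have qE : q = 1 + t by rewrite -[t]opprK -qt subKr.
split=> t0; last by rewrite -opprD oppr_eq0 lt_eqF // -[ltRHS](addr0 0) ltrD.
have q0 : 0 <= q by rewrite qE addr_ge0.
move: q1; rewrite ger0_norm // qE gerDl => t1.
by rewrite (le_anti (_ : t <= 0 <= t)) ?t1 // oppr0 addr0.
Qed.

Lemma star_mult_of (c : C) : star (mult_of c) = mult_of (star c).
Proof. by apply: mult_eqP => x /=; rewrite starM starK. Qed.

(** With l = chi0 c, take [k] from the negative part of h = |c - l|^2 - e^2, formed among
    multipliers since [C] may lack a unit. A star-preserving [chi] sees |chi c - l|^2 - e^2,
    nonnegative far from [chi0], whereas [chi0] sees -e^2. *)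
Lemma char_separate (chi0 : character C) (c : C) (e : R[i]) : 0 < e ->
  exists k, chi0 k != 0 /\ forall chi : character C,
    (forall x, chi (star x) = Num.conj (chi x)) ->
    e <= `|chi c - chi0 c| -> chi k = 0.
Proof.
move=> e0; have [u0 u01] := char_eq1 chi0.
pose l := chi0 c; pose m : multiplier C := mult_of c - l *: mult_id.
have mE x : m x = c ** x - l *: x by rewrite multB_app.
have smE x : (star m : multiplier C) x = star c ** x - Num.conj l *: x.
  rewrite /m -scaleN1r starD !starZ star_mult_of /= rmorphN1 scaleN1r.
  by congr (_ - _ *: _); rewrite /= starK.
pose h : multiplier C := star m ** m - (e ^+ 2) *: mult_id.
have hE x : h x = (star m : multiplier C) (m x) - e ^+ 2 *: x.
  by rewrite multB_app.
have sh : star h = h.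
  rewrite /h -scaleN1r starD !starZ starM starK; congr (_ + _).
  rewrite rmorphN1 rmorphXn /= conj_Creal ?gtr0_real //; congr (_ *: (_ *: _)).
  by apply: mult_sa => x y.
pose M := (`|c| + `|l|) ^+ 2 + e ^+ 2.
have M0 : 0 < M by rewrite ltr_wpDl ?exprn_ge0 ?addr_ge0 // exprn_gt0.
have mN x : `|m x| <= (`|c| + `|l|) * `|x|.
  rewrite mE mulrDl (le_trans (ler_normB _ _)) // lerD ?norm_amul_le //.
  by rewrite normrZ.
have smN x : `|(star m : multiplier C) x| <= (`|c| + `|l|) * `|x|.
  rewrite smE mulrDl (le_trans (ler_normB _ _)) // lerD //.
    by rewrite (le_trans (norm_amul_le _ _)) // norm_star.
  by rewrite normrZ norm_conjC.
have hN x : `|h x| <= M * `|x|.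
  rewrite hE /M mulrDl (le_trans (ler_normB _ _)) // lerD //.
    by rewrite (le_trans (smN _)) // expr2 -mulrA ler_wpM2l ?addr_ge0.
  by rewrite normrZ ger0_norm // exprn_ge0 // ltW.
pose T : multiplier C := M^-1 *: h.
have MV : 0 < M^-1 by rewrite invr_gt0.
have sT : star T = T by rewrite starZ sh conj_Creal // gtr0_real.
have cT : contraction T.
  move=> x; rewrite [T x]/(M^-1 *: h x) normrZ gtr0_norm //.
  by rewrite ler_pdivrMl.
have [N NP] := char_negative_part sT cT; exists (N u0); split.
  have [_] := NP chi0 u0 u01; apply.
  (* Compatibility of [chi0] with [star] is not assumed: commuting [m] to the outside exposes the
     factor [chi0 c - l], which is 0. *)
  rewrite [T u0]/(M^-1 *: h u0) charZ pmulr_rlt0 // hE (mult_comm (star m) m).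
  rewrite charB mE charB charM !charZ u01 -/l subrr sub0r oppr_lt0 mulr1.
  by rewrite exprn_gt0.
move=> chi schi ec; have [u u1] := char_eq1 chi.
rewrite (char_mult N u0 u1); have [->] := NP chi u u1; first by rewrite mul0r.
rewrite [T u]/(M^-1 *: h u) charZ pmulr_rge0 // hE charB smE charB charM !charZ.
rewrite schi mE charB charM charZ u1 !mulr1 -mulrBl -rmorphB /=.
rewrite mulrC -normCK subr_ge0 lerXn2r // nnegrE ?(ltW e0) //.
Qed.

End commutative_multipliers.

(** * The spectrum *)

Section spectrum_topology.
Variables (R : realType) (C : cstarType R).
Local Notation Cx := (R[i]^o).
Local Notation ev c := (fun chi : spectrum C => (chi : character C) c : Cx).

Lemma spectrum_eval_continuous (c : C) : continuous (ev c).
Proof.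
move=> chi; apply: (@continuous_comp (spectrum C) {ptws C -> Cx} Cx
  (@char_fun R C) (fun h => h c)).
  exact: initial_continuous.
exact: (@proj_continuous C (fun=> Cx) c).
Qed.

Lemma spectrum_cvg (F : set_system (spectrum C)) (chi : spectrum C) :
  Filter F -> (forall c, ev c @ F --> ev c chi) -> F --> chi.
Proof.
move=> FF Fc B [_ [[W oW <-] /= Wchi] WB].
have Fp : {ptws, (@char_fun R C @ F) --> (chi : C -> Cx)}.
  by apply: (@pointwise_cvgP C Cx _ _ _).2 => c; exact: Fc.
apply: filterS WB _; apply: Fp; exact: open_nbhs_nbhs.
Qed.

Lemma character_eq (chi chi' : character C) :
  (forall c, chi c = chi' c) -> chi = chi'.
Proof.
move=> E; have {E} : char_fun chi = char_fun chi' by apply/funext.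
case: chi chi' => [f fD fZ fM f0] [g gD gZ gM g0] /= fg.
rewrite -fg in gD gZ gM g0 *; congr Character; exact: Prop_irrelevance.
Qed.

Lemma spectrum_hausdorff : hausdorff_space (spectrum C).
Proof.
move=> chi chi' cl; apply: character_eq => c.
apply: (@norm_hausdorff R[i] Cx) => A B cA cB.
have [||l [lA lB]] := cl (ev c @^-1` A) (ev c @^-1` B).
- exact: spectrum_eval_continuous.
- exact: spectrum_eval_continuous.
by exists (ev c l).
Qed.

(** Alaoglu's argument: by [char_norm_le] the values at each [x] stay in a compact disc, so an
    ultrafilter converges pointwise. The limit is multiplicative, and the lower bound [d] at [c]
    keeps it nonzero. *)
Lemma spectrum_compact (c : C) (d : R[i]) : 0 < d ->
  compact [set chi : spectrum C | d <= `|(chi : character C) c|].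
Proof.
move=> d0; rewrite compact_ultra => F FU Fd.
have lim x : {l : Cx | ev x @ F --> l}.
  apply: cid; have Fx : F (ev x @^-1` [set z : Cx | `|z| <= `|x|]).
    by apply: filterS filterT => chi _ /=; exact: char_norm_le.
  have cD := @closed_disc_compact R `|x|.
    by have [l _ Fl] := ultra_cvg_compact FU cD Fx; exists l.
pose l x : R[i] := sval (lim x).
have lP x : ev x @ F --> (l x : Cx) by exact: svalP (lim x).
have lu x (y : Cx) : ev x @ F --> y -> l x = y.
  by move=> Fy; exact: norm_cvg_unique (lP x) Fy.
have lD : {morph l : x y / x + y}.
  move=> x y; apply: lu; rewrite (_ : ev (x + y) = ev x \+ ev y).
    by apply: cvgD; exact: lP.
  by apply/funext => chi; exact: charD.
have lM x y : l (x ** y) = l x * l y.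
  apply: lu; rewrite (_ : ev (x ** y) = ev x \* ev y).
    by apply: (@cvgM R[i]); exact: lP.
  by apply/funext => chi; exact: charM.
have lZ k x : l (k *: x) = k * l x.
  apply: lu; rewrite (_ : ev (k *: x) = k \*: ev x).
    by apply: (@cvgZr R[i] Cx); exact: lP.
  by apply/funext => chi; exact: charZ.
have ld : d <= `|l c|.
  have cl : closed [set z : Cx | d <= `|z|].
    by apply: (@closed_le_norm R Cx id) => // z.
  exact: (closed_cvg _ cl Fd _ (lP c)).
have l0 : exists x, l x != 0.
  by exists c; rewrite -normr_gt0 (lt_le_trans d0).
by exists (Character lD lZ lM l0 : spectrum C); split => //; exact: spectrum_cvg.
Qed.

Lemma spectrum_nbhs_gt (chi : spectrum C) (c : C) (d : R[i]) :
  0 <= d -> d < `|(chi : character C) c| ->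
  open_nbhs chi [set chi' : spectrum C | d < `|(chi' : character C) c|].
Proof.
move=> d0 dc; split => //.
rewrite (_ : mkset _ = ~` [set chi' : spectrum C | `|ev c chi'| <= d]).
  apply: closed_openC; apply: closed_norm_le; exact: spectrum_eval_continuous.
apply/seteqP; split=> x /=; first by move=> /lt_geF ->.
by move=> /negP; rewrite -real_ltNge ?normr_real // ger0_real.
Qed.

Lemma spectrum_locally_compact : locally_compact [set: spectrum C].
Proof.
move=> chi _; have [u u1] := char_eq1 (chi : character C).
have h0 : (0 : R[i]) < 2^-1 by rewrite invr_gt0.
rewrite withinET; exists [set chi' : spectrum C | 2^-1 <= `|ev u chi'|].
  apply: (@filterS _ _ _ [set chi' : spectrum C | 2^-1 < `|ev u chi'|]).
    by move=> x /=; exact: ltW.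
  apply: open_nbhs_nbhs; apply: spectrum_nbhs_gt; first exact: ltW.
  by rewrite u1 normr1 invf_lt1 // ltr1n.
split; first exact: spectrum_compact.
by apply: closed_le_norm => //; exact: spectrum_eval_continuous.
Qed.

End spectrum_topology.

(** [P] defines an ideal of sets. Were [K] not in it, the sets whose complement in [K] satisfies [P]
    would form a proper filter, and [P] near a cluster point of it gives a contradiction. *)
Lemma compact_local_global (T : topologicalType) (P : set T -> Prop) (K : set T) :
  compact K -> P set0 -> (forall A B, A `<=` B -> P B -> P A) ->
  (forall A B, P A -> P B -> P (A `|` B)) ->
  (forall y, K y -> exists2 V, nbhs y V & P V) -> P K.
Proof.
move=> cK P0 PS PU PL; apply: contrapT => nPK.
pose F : set_system T := [set A | P (K `&` ~` A)].
have FF : ProperFilter F.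
  split; first by rewrite /F /= setC0 setIT.
  split; first by rewrite /F /= setCT setI0.
    by move=> A B FA FB; rewrite /F /= setCI setIUr; exact: PU.
  by move=> A B AB; apply: PS => x [Kx nBx]; split => // /AB.
have [|y [Ky Fy]] := cK F FF; first by rewrite /F /= setICr.
have [V yV PV] := PL y Ky.
have FV : F (~` V) by apply: PS PV => x [_ /=]; exact: contrapT.
by have [x []] := Fy _ _ FV yV.
Qed.

(** * Characters of C_0(Y) are evaluations *)

Section C0_characters.
Variables (R : realType) (Y : topologicalType).
Hypotheses (hY : hausdorff_space Y) (lcY : locally_compact [set: Y]).
Local Notation Cx := (R[i]^o).
Local Notation A := (C0 R Y).

(** Near a point where [a] is nonzero, a multiple of [star a ** a] exceeds [N] and stays in the
    kernel; nonnegativity lets such local solutions be added. *)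
Lemma kernel_positive (chi : character A) (K : set Y) (N : R[i]) : 0 <= N ->
  compact K -> (forall y, exists2 a : A, chi a = 0 & a y != 0) ->
  exists b : A, [/\ chi b = 0, forall y, 0 <= b y & forall y, K y -> N <= b y].
Proof.
move=> N0 cK ker; pose P U := exists b : A,
  [/\ chi b = 0, forall y, 0 <= b y & forall y, U y -> N <= b y].
apply: (@compact_local_global Y P K cK).
- by exists 0; split => //; exact: char0.
- by move=> U V UV [b [b0 bp bV]]; exists b; split => // y /UV; exact: bV.
- move=> U V [b [b0 bp bU]] [b' [b'0 b'p b'V]]; exists (b + b'); split.
  + by rewrite charD b0 b'0 addr0.
  + by move=> y; rewrite [leRHS]/(b y + b' y) addr_ge0.
  + move=> y; rewrite [(b + b') y]/(b y + b' y) => -[/bU|/b'V] Ny.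
      by rewrite (le_trans Ny) // lerDl.
    by rewrite (le_trans Ny) // lerDr.
- move=> y _; have [a a0 ay] := ker y.
  pose k := N / (`|a y| / 2) ^+ 2.
  have h0 : 0 < `|a y| / 2 by rewrite divr_gt0 // normr_gt0.
  have k0 : 0 <= k by rewrite divr_ge0 // exprn_ge0 // ltW.
  have bE z : (k *: (star a ** a)) z = k * `|a z| ^+ 2.
    by rewrite [LHS]/(k * (Num.conj (a z) * a z)) normCK [a z * _]mulrC.
  exists [set z | `|a y| / 2 <= `|a z|].
    have /(@cvgrPdist_lt R[i] Cx)/(_ _ h0) : {for y, continuous a}.
      exact: C0_continuous.
    apply: filterS => z az /=.
    have : `|a y| <= `|a y - a z| + `|a z|.
      by rewrite -{1}(subrK (a z) (a y)) ler_normD.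
    rewrite -lerBlDl; apply: le_trans.
    by rewrite {2}(splitr `|a y|) -addrA lerDl subr_ge0 ltW.
  exists (k *: (star a ** a)); split.
  + by rewrite charZ charM a0 !mulr0.
  + by move=> z; rewrite bE mulr_ge0 // exprn_ge0.
  + move=> z az; rewrite bE /k mulrAC ler_pdivlMr ?exprn_gt0 //.
    by rewrite ler_wpM2l // lerXn2r // nnegrE // ltW.
Qed.

(* If [chi b = 0] and [w = a / (1 + b)] then [a = w + b w] has
   [chi a = chi w], although [w] is small where [b] is large. *)
Lemma divide_1D (a b : A) : (forall y, 0 <= b y) ->
  exists w : A, forall y, w y * (1 + b y) = a y.
Proof.
move=> b0; pose v y : Cx := (1 + b y)^-1.
have p y : 0 < 1 + b y by rewrite ltr_pwDl.
have cv : continuous v.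
  move=> y; apply: (@cvgV R[i] _ _ _ (fun y => 1 + b y : Cx) (1 + b y : Cx)).
    by rewrite gt_eqF.
  by apply: (@cvgD R[i] Cx); [exact: cvg_cst|exact: C0_continuous].
have v1 y : `|v y| <= 1.
  by rewrite /v normfV gtr0_norm // invf_le1 // lerDl.
exists (mkC0 (continuousM_C cv (@C0_continuous _ _ a))
          (vanishingM cv (@C0_continuous _ _ a) v1 (@C0_vanishing _ _ a))) => y.
transitivity (((1 + b y)^-1 : R[i]) * a y * (1 + b y)) => //.
by rewrite mulrAC mulVf ?mul1r // gt_eqF.
Qed.

(** Otherwise some [b >= 0] in the kernel is at least twice the norm of [a0] on [K]. Then w = a0 /
    (1 + b) has [chi w = 1] but norm at most 1/2, by the size of [b] on [K] and of [a0] elsewhere,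
    against [char_norm_le]. *)
Lemma C0_char_kernel (chi : character A) :
  exists y, forall a : A, chi a = 0 -> a y = 0.
Proof.
apply: contrapT => nex.
have ker y : exists2 a : A, chi a = 0 & a y != 0.
  apply: contrapT => na; apply: nex; exists y => a a0.
  by apply/eqP/negPn/negP => ay; apply: na; exists a.
have [a0 a01] := char_eq1 chi.
pose K := [set y | (2^-1 : R[i]) <= `|a0 y|].
have h0 : (0 : R[i]) < 2^-1 by rewrite invr_gt0.
have cK : compact K by exact: (C0_vanishing (f := a0)).
have N0 : (0 : R[i]) <= 2 * C0_norm a0 by rewrite mulr_ge0 // C0_norm_ge0.
have [b [chib bp bK]] := kernel_positive N0 cK ker.
have [w wE] := divide_1D a0 bp.
have chiw : chi w = 1.
  rewrite -a01 (_ : a0 = w + w ** b); last first.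
    by apply: C0_eqP => y; rewrite -wE mulrDr mulr1.
  by rewrite charD charM chib mulr0 addr0.
have : `|w| <= 2^-1.
  rewrite C0_normE; apply: C0_norm_le; first exact: ltW.
  move=> y; have p : 0 < 1 + b y by rewrite ltr_pwDl.
  have -> : w y = a0 y / (1 + b y) by rewrite -wE mulfK // gt_eqF.
  rewrite normrM normfV (gtr0_norm p) ler_pdivrMr //.
  have [Ky|nKy] := pselect (K y).
    apply: le_trans (C0_norm_ub a0 y) _; rewrite -(ler_pdivrMl _ _ h0) invrK.
    by rewrite (le_trans (bK y Ky)) // lerDr.
  have ay : `|a0 y| <= 2^-1.
    by move/negP : nKy; rewrite -real_ltNge ?normr_real ?gtr0_real // => /ltW.
  by rewrite (le_trans ay) // ler_peMr ?(ltW h0) // lerDl.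
apply/negP; rewrite -real_ltNge ?normr_real ?gtr0_real //.
apply: lt_le_trans (char_norm_le chi w).
by rewrite chiw normr1 invf_lt1 // ltr1n.
Qed.

(** Inclusion of kernels makes evaluation at [y] a multiple of [chi]; multiplicativity at [e ** e],
    where [e y = 1], makes the factor 1. *)
Lemma C0_char_eval (chi : character A) : exists y, forall a : A, a y = chi a.
Proof.
have [y ky] := C0_char_kernel chi; exists y.
have [e [_ e1 _]] := C0_bump R hY lcY openT (I : [set: Y] y).
have e0 : chi e != 0.
  by apply/eqP => /ky; rewrite e1 => /eqP; rewrite oner_eq0.
have E (a : A) : a y = chi a / chi e.
  have : chi (a - (chi a / chi e) *: e) = 0.
    by rewrite charB charZ divfK // subrr.
  move=> /ky; rewrite [LHS]/(a y - chi a / chi e * e y) e1 mulr1 => /eqP.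
  by rewrite subr_eq0 => /eqP.
have chie : chi e = 1.
  have : (e ** e) y = 1 by rewrite [LHS](_ : _ = e y * e y) // e1 mulr1.
  by rewrite E charM mulfK.
by move=> a; rewrite E chie divr1.
Qed.

End C0_characters.

(** * From C*-algebras to fibrewise compactifications *)

Section star_hom_theory.
Variables (R : realType) (A B : starAlgType R) (phi : A -> B).
Hypothesis hphi : star_hom phi.

Lemma star_homD x y : phi (x + y) = phi x + phi y.
Proof. by have [l _ _] := hphi; rewrite -[x]scale1r l !scale1r. Qed.

Lemma star_hom0 : phi 0 = 0.
Proof. by apply: (@addrI _ (phi 0)); rewrite -star_homD !addr0. Qed.

Lemma star_homZ k x : phi (k *: x) = k *: phi x.
Proof. by have [l _ _] := hphi; rewrite -[k *: x]addr0 l star_hom0 addr0. Qed.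

Lemma star_homB x y : phi (x - y) = phi x - phi y.
Proof. by rewrite star_homD -scaleN1r star_homZ scaleN1r. Qed.

Lemma star_homM x y : phi (x ** y) = phi x ** phi y.
Proof. by have [_ m _] := hphi; exact: m. Qed.

Lemma star_homJ x : phi (star x) = star (phi x).
Proof. by have [_ _ s] := hphi; exact: s. Qed.

End star_hom_theory.

Lemma C0_amulC (R : realType) (T : topologicalType) (a b : C0 R T) :
  a ** b = b ** a.
Proof. by apply: C0_eqP => t; exact: mulrC. Qed.

(** * The annihilator of an ideal *)

Section ideal_annihilator.
Variables (R : realType) (B C : cstarType R) (iota : B -> C).
Hypothesis iotaP : ideal_embedding iota.
Local Notation J := (annihilator (range iota)).

Let hiota : star_hom iota. Proof. by case: iotaP. Qed.
Let iI : injective iota. Proof. by case: iotaP. Qed.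

Lemma range_ideall c b : range iota (c ** iota b).
Proof. by exists (induced_l iotaP c b) => //; rewrite iota_induced_l. Qed.

Lemma range_idealr c b : range iota (iota b ** c).
Proof. by exists (induced_r iotaP c b) => //; rewrite iota_induced_r. Qed.

Lemma annihilator_iota d b : J d -> d ** iota b = 0.
Proof. by apply; exists b. Qed.

Lemma annihilatorP d : (forall b, d ** iota b = 0) -> J d.
Proof. by move=> db _ [b _ <-]. Qed.

Lemma iota_ann_eq0 b : J (iota b) -> b = 0.
Proof.
move=> Jb; apply: iI; rewrite (star_hom0 hiota); apply: star_inj.
rewrite -[0 in RHS](scale0r 0) starZ conjC0 scale0r.
apply: star_amul_eq0; rewrite starK -(star_homJ hiota); exact: annihilator_iota.
Qed.

Lemma annihilatorB d e : J d -> J e -> J (d - e).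
Proof.
move=> Jd Je; apply: annihilatorP => b.
by rewrite amulBl !annihilator_iota // subrr.
Qed.

Lemma annihilator_mull c d : J d -> J (c ** d).
Proof.
by move=> Jd; apply: annihilatorP => b; rewrite -amulA annihilator_iota // amul0r.
Qed.

Lemma annihilator_mulr c d : J d -> J (d ** c).
Proof.
by move=> Jd; apply: annihilatorP => b; rewrite -amulA; exact: Jd (range_ideall c b).
Qed.

Lemma amul_star_eq0 (x : C) : x ** star x = 0 -> x = 0.
Proof.
move=> x0; apply: star_inj; rewrite -[0 in RHS](scale0r 0) starZ conjC0 scale0r.
by apply: star_amul_eq0; rewrite starK.
Qed.

(** [annihilator] is defined one-sidedly. For the other side, x = iota b ** d has x ** star x = 0,
    since the inner factor [d ** star d] lies in [J] and kills [iota (star b)]. *)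
Lemma annihilator_iotal d b : J d -> iota b ** d = 0.
Proof.
move=> Jd; apply: amul_star_eq0.
rewrite starM -(star_homJ hiota) -amulA [d ** _]amulA.
by rewrite (annihilator_iota _ (annihilator_mulr _ Jd)) amul0r.
Qed.

Lemma annihilator_star d : J d -> J (star d).
Proof.
move=> Jd; apply: annihilatorP => b; apply: star_inj.
rewrite starM starK -(star_homJ hiota) annihilator_iotal //.
by rewrite -[0 in RHS](scale0r 0) starZ conjC0 scale0r.
Qed.

Lemma annihilator_eq0 d : J d -> (forall e, J e -> e ** d = 0) -> d = 0.
Proof.
by move=> Jd d0; apply: star_amul_eq0; apply: d0; exact: annihilator_star.
Qed.

(* An annihilator ideal that is commutative is central; if moreover [B] is
   commutative, then all commutators of [C] lie in it and are annihilated by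
   it. *)
Lemma commutative_extension : (forall x y : B, x ** y = y ** x) ->
  (forall d e, J d -> J e -> d ** e = e ** d) ->
  forall x y : C, x ** y = y ** x.
Proof.
move=> hB hJ.
have Jc d c : J d -> d ** c = c ** d.
  move=> Jd; apply/eqP; rewrite -subr_eq0; apply/eqP.
  apply: annihilator_eq0 => [|e Je].
    by apply: annihilatorB; [exact: annihilator_mulr|exact: annihilator_mull].
  have Jec : J (e ** c) by exact: annihilator_mulr.
  by rewrite amulBr !amulA (hJ _ _ Jec Jd) !amulA (hJ e d) // subrr.
move=> x y; apply/eqP; rewrite -subr_eq0; apply/eqP.
apply: annihilator_eq0 => [|d Jd].
  apply: annihilatorP => b; rewrite amulBl -!amulA.
  rewrite -!(iota_induced_l iotaP).
  have := mult_comm hB (induced_mor iotaP x) (induced_mor iotaP y) b.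
  by rewrite /= => ->; rewrite subrr.
have Jdx : J (d ** x) by exact: annihilator_mulr.
by rewrite amulBr !amulA (Jc _ _ Jdx) !amulA -(Jc d y Jd) subrr.
Qed.

End ideal_annihilator.

(** * Commutativity of C and the points of X in its spectrum *)

Section compactification_spectrum.
Variables (R : realType) (X Y : topologicalType).
Hypotheses (hX : hausdorff_space X) (lcX : locally_compact [set: X]).
Hypotheses (hY : hausdorff_space Y) (lcY : locally_compact [set: Y]).
Variables (f : X -> Y) (cf : continuous f).
Variables (C : cstarType R) (psi : C0 R Y -> C) (iota : C0 R X -> C).
Hypothesis iotaP : ideal_embedding iota.
Hypothesis psiP : Morp psi.
Hypothesis alpha_psi : induced_mor iotaP \o psi = pullback (R := R) cf.
Local Notation Cx := (R[i]^o).
Local Notation J := (annihilator (range iota)).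
Hypothesis nf2 : [set coset (range iota) c | c in J] `<=`
  [set coset (range iota) (psi a) | a in Pim (pullback (R := R) cf)].

Let hiota : star_hom iota. Proof. by case: iotaP. Qed.
Let iI : injective iota. Proof. by case: iotaP. Qed.
Let hpsi : star_hom psi. Proof. by case: psiP. Qed.

(** Elementwise form of (NF2): equality of cosets yields [b], and [b'] is the function in C_0(X)
    witnessing that [a] lies in [Pim]. *)
Lemma annihilator_decomp d : J d -> exists (a : C0 R Y) (b b' : C0 R X),
  d = psi a + iota b /\ forall x, a (f x) = b' x.
Proof.
move=> Jd; have [|a [b' _ ab'] /seteqP[_ cd]] := nf2 (t := coset (range iota) d).
  by exists d.
have [|_ [b _ <-] db] := cd d.
  by exists 0; [exists 0 => //; exact: star_hom0|rewrite addr0].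
exists a, b, b'; split => // x.
have [u [_ u1 _]] := C0_bump R hX lcX openT (I : [set: X] x).
have := congr1 (fun T : multiplier (C0 R X) => T u x) ab'.
rewrite (_ : pullback cf a u x = a (f x) * u x) //.
by rewrite (_ : mult_of b' u x = b' x * u x) // u1 !mulr1 => ->.
Qed.

Lemma range_iota_mulB a a' b b' :
  exists b'', (psi a + iota b) ** (psi a' + iota b') = psi (a ** a') + iota b''.
Proof.
have [b1 _ e1] := range_ideall iotaP (psi a) b'.
have [b2 _ e2] := range_idealr iotaP (psi a') b.
exists (b1 + (b2 + b ** b')).
rewrite amulDl !amulDr !(star_homD hiota) e1 e2 (star_homM hiota) (star_homM hpsi).
by rewrite !addrA.
Qed.

(** Modulo the ideal, elements of [J] are images of functions on [Y], which commute. Their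
    commutator lies in [J] and in the ideal, so it is 0. *)
Lemma compactification_comm : forall x y : C, x ** y = y ** x.
Proof.
apply: (commutative_extension iotaP); first exact: C0_amulC.
move=> d e Jd Je; have [a [b [_ [dE _]]]] := annihilator_decomp Jd.
have [a' [b' [_ [eE _]]]] := annihilator_decomp Je.
have [b1 de] := range_iota_mulB a a' b b'.
have [b2 ed] := range_iota_mulB a' a b' b.
have E : d ** e - e ** d = iota (b1 - b2).
  rewrite dE eE de ed C0_amulC opprD addrACA subrr add0r.
  by rewrite (star_homB hiota).
have JE : J (iota (b1 - b2)).
  by rewrite -E; apply: annihilatorB; exact: annihilator_mull.
apply/eqP; rewrite -subr_eq0 E (iota_ann_eq0 iotaP JE).
by rewrite (star_hom0 hiota).
Qed.

Local Notation M := (induced_mor iotaP).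
Let hC := compactification_comm.

Lemma iota_M c b : iota (M c b) = c ** iota b.
Proof. exact: iota_induced_l. Qed.

Lemma M_psi a b x : M (psi a) b x = a (f x) * b x.
Proof. by rewrite -[M (psi a)]/((M \o psi) a) alpha_psi. Qed.

Definition bump x : C0 R X := sval (cid (C0_bump R hX lcX openT (I : [set: X] x))).

Lemma bump1 x : bump x x = 1.
Proof. by rewrite /bump; case: cid => ? []. Qed.

Definition point_char_fun x (c : C) : R[i] := M c (bump x) x.

Lemma point_char_mul x c b : M c b x = point_char_fun x c * b x.
Proof.
have /(congr1 (fun h : C0 R X => h x)) := mult_swap (@C0_amulC R X) (M c) b (bump x).
rewrite [LHS](_ : _ = b x * point_char_fun x c) //.
rewrite [RHS](_ : _ = M c b x * bump x x) // bump1 mulr1 => <-.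
exact: mulrC.
Qed.

Lemma point_char_iota x b : point_char_fun x (iota b) = b x.
Proof.
have E : M (iota b) (bump x) = b ** bump x.
  by apply: iI; rewrite iota_M (star_homM hiota).
by rewrite /point_char_fun E [LHS](_ : _ = b x * bump x x) // bump1 mulr1.
Qed.

Fact point_charD x : {morph point_char_fun x : c d / c + d}.
Proof.
move=> c d; rewrite /point_char_fun.
suff -> : M (c + d) (bump x) = M c (bump x) + M d (bump x) by [].
by apply: iI; rewrite (star_homD hiota) !iota_M amulDl.
Qed.

Fact point_charZ x k c : point_char_fun x (k *: c) = k * point_char_fun x c.
Proof.
rewrite /point_char_fun; suff -> : M (k *: c) (bump x) = k *: M c (bump x) by [].
by apply: iI; rewrite (star_homZ hiota) !iota_M amulZl.
Qed.

Fact point_charM x c d :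
  point_char_fun x (c ** d) = point_char_fun x c * point_char_fun x d.
Proof.
rewrite -point_char_mul /point_char_fun.
suff -> : M (c ** d) (bump x) = M c (M d (bump x)) by [].
by apply: iI; rewrite !iota_M amulA.
Qed.

Fact point_char_neq0 x : exists c, point_char_fun x c != 0.
Proof. by exists (iota (bump x)); rewrite point_char_iota bump1 oner_eq0. Qed.

Definition point_char x : spectrum C :=
  Character (@point_charD x) (@point_charZ x) (@point_charM x) (@point_char_neq0 x).

Lemma point_charE x c : (point_char x : character C) c = point_char_fun x c.
Proof. by []. Qed.

(** Needed to apply [char_separate] at the points of [X]. Multiplying by an element of the ideal
    reduces it to conjugation in C_0(X). *)
Lemma point_char_star x c :
  point_char_fun x (star c) = Num.conj (point_char_fun x c).
Proof.
have -> : point_char_fun x (star c) =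
    point_char_fun x (star c ** star (iota (star (bump x)))).
  by rewrite point_charM -(star_homJ hiota) starK point_char_iota bump1 mulr1.
rewrite -starM hC -iota_M -(star_homJ hiota) point_char_iota.
rewrite [LHS](_ : _ = Num.conj (M c (star (bump x)) x)) // point_char_mul.
rewrite (_ : star (bump x) x = Num.conj (bump x x)) // bump1.
by rewrite (conj_Creal (real1 _)) mulr1.
Qed.

Lemma annihilator_point d : J d <-> forall x, point_char_fun x d = 0.
Proof.
split=> [Jd x|d0].
  rewrite /point_char_fun (_ : M d (bump x) = 0) //.
  by apply: iI; rewrite iota_M annihilator_iota // (star_hom0 hiota).
apply: annihilatorP => b; rewrite -iota_M (_ : M d b = 0) ?(star_hom0 hiota) //.
by apply: C0_eqP => x; rewrite point_char_mul d0 mul0r.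
Qed.

(** Restricted to the ideal, [chi] is a character of C_0(X), hence an evaluation; its values on [C]
    follow from those on [c ** iota b] by division. *)
Lemma char_on_ideal (chi : character C) b : chi (iota b) != 0 ->
  exists2 x, chi = point_char x & b x != 0.
Proof.
move=> chib.
have cD : {morph (fun b => chi (iota b)) : b b' / b + b'}.
  by move=> u v; rewrite (star_homD hiota) charD.
have cZ k u : chi (iota (k *: u)) = k * chi (iota u).
  by rewrite (star_homZ hiota) charZ.
have cM u v : chi (iota (u ** v)) = chi (iota u) * chi (iota v).
  by rewrite (star_homM hiota) charM.
have [x xE] := C0_char_eval hX lcX
  (Character cD cZ cM (ex_intro (fun b => chi (iota b) != 0) b chib)).
exists x; last by rewrite xE.
apply: character_eq => c; apply: (mulIf chib).
rewrite -charM -iota_M -[LHS](xE (M c b)) point_char_mul.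
by congr (_ * _); exact: xE.
Qed.

Lemma char_psi_neq0 (chi : character C) : exists a, chi (psi a) != 0.
Proof.
apply: contrapT => nex; have psi0 a : chi (psi a) = 0.
  by apply/eqP/negPn/negP => ca; apply: nex; exists a.
have [u u1] := char_eq1 chi; have [_ dense] := psiP.
have : closure (lin_span [set psi a ** b | a in setT & b in setT]) u.
  by rewrite dense.
have b12 : nbhs u (ball u (1 : R[i])) by exact: nbhsx_ballx.
move=> /(_ _ b12)[s [ss]]; rewrite -ball_normE /= => us.
have cs : chi s = 0.
  apply: (ss [set c | chi c = 0]); split.
    by split=> [|k x y /= x0 y0]; rewrite /= ?char0 // charD charZ x0 y0 mulr0 addr0.
  by move=> _ [a _ [b _ <-]] /=; rewrite charM psi0 mul0r.
have := le_lt_trans (char_norm_le chi (u - s)) us.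
by rewrite charB u1 cs subr0 normr1 ltxx.
Qed.

Lemma gelfand_dual_ex : exists g : spectrum C -> Y, gelfand_dual psi g.
Proof.
have point (chi : spectrum C) :
    exists y, forall a : C0 R Y, a y = (chi : character C) (psi a).
  have cD : {morph (fun a => (chi : character C) (psi a)) : b b' / b + b'}.
    by move=> u v; rewrite (star_homD hpsi) charD.
  have cZ k u : (chi : character C) (psi (k *: u)) = k * (chi : character C) (psi u).
    by rewrite (star_homZ hpsi) charZ.
  have cM u v : (chi : character C) (psi (u ** v)) =
      (chi : character C) (psi u) * (chi : character C) (psi v).
    by rewrite (star_homM hpsi) charM.
  exact: (C0_char_eval hY lcY (Character cD cZ cM (char_psi_neq0 chi))).
by have [g gP] := choice point; exists g => chi a; exact: gP.
Qed.

(** * The dual map g as a fibrewise compactification *)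

Section dual_map.
Variables (g : spectrum C -> Y) (gP : gelfand_dual psi g).

Lemma dual_continuous : continuous g.
Proof.
move=> chi O; rewrite nbhsE => -[U [oU Ug] UO].
have [a [_ a1 aU]] := C0_bump R hY lcY oU Ug.
apply: (@filterS _ (nbhs chi) _
    [set chi' : spectrum C | 0 < `|(chi' : character C) (psi a)|]).
  move=> chi' /=; rewrite -gP normr_gt0 => /aU; exact: UO.
apply: open_nbhs_nbhs; apply: spectrum_nbhs_gt => //.
by rewrite -gP a1 normr1 ltr01.
Qed.

Lemma dual_proper : proper_map g.
Proof.
move=> K cK; have [a [_ a1 _]] := C0_cutoff R hY lcY cK openT (fun _ _ => I).
apply: (subclosed_compact _ (@spectrum_compact R C (psi a) 1 ltr01)).
  apply: closed_comp; first by move=> chi _; exact: dual_continuous.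
  exact: compact_closed.
by move=> chi /= Kg; rewrite -gP a1 // normr1.
Qed.

Lemma dual_point x : g (point_char x) = f x.
Proof.
apply: (C0_sep_inj hY lcY (R := R)) => a.
by rewrite gP point_charE /point_char_fun M_psi bump1 mulr1.
Qed.

Lemma point_char_inclusion : open_inclusion point_char.
Proof.
split.
- move=> x; apply: spectrum_cvg => c.
  have [K xK [cK _]] := lcX (x := x) I; rewrite withinET in xK.
  have [b [_ b1 _]] := C0_cutoff R hX lcX cK openT (fun _ _ => I).
  have bx : b x = 1 by apply: b1; exact: nbhs_singleton.
  have cM : (fun z => M c b z : Cx) @ x --> (M c b x : Cx) by exact: C0_continuous.
  have cp : (fun z => point_char_fun z c : Cx) @ x --> (M c b x : Cx).
    apply: (@cvg_trans _ _ _ _ _ cM); apply: near_eq_cvg.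
    by apply: filterS xK => z /b1 bz; rewrite /= point_char_mul bz mulr1.
  by move: cp; rewrite point_char_mul bx mulr1.
- move=> x x' xx'; apply: (C0_sep_inj hX lcX (R := R)) => b.
  by rewrite -!point_char_iota -!point_charE xx'.
- move=> U oU; rewrite openE => _ [x Ux <-].
  have [b [_ b1 bU]] := C0_bump R hX lcX oU Ux.
  apply: (@filterS _ (nbhs (point_char x)) _
      [set chi' : spectrum C | 0 < `|(chi' : character C) (iota b)|]).
    by move=> chi' /=; rewrite normr_gt0 => /char_on_ideal[x' -> /bU]; exists x'.
  apply: open_nbhs_nbhs; apply: spectrum_nbhs_gt => //.
  by rewrite point_charE point_char_iota b1 normr1 ltr01.
Qed.

Local Notation S := (~` closure (range point_char)).

(* The sets [B] such that some [k] with [chi k != 0] vanishes at all points of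
   [X] outside [B] form a filter, which converges to [chi] by
   [char_separate]. *)
Lemma char_off_closure (chi : spectrum C) : S chi ->
  exists2 d, J d & (chi : character C) d != 0.
Proof.
move=> Schi; pose F : set_system (spectrum C) := [set B | exists k,
  (chi : character C) k != 0 /\
  forall x, ~ B (point_char x) -> point_char_fun x k = 0].
have FF : Filter F.
  split.
  - by have [u u0] := char_neq0 (chi : character C); exists u; split=> // x [].
  - move=> A B [k [k0 kA]] [l [l0 lB]]; exists (k ** l).
    rewrite charM mulf_neq0 //; split=> // x /not_andP[/kA|/lB] E;
      by rewrite point_charM E ?mul0r ?mulr0.
  - move=> A B AB [k [k0 kA]]; exists k; split=> // x nB; apply: kA.
    by move=> /AB.
have Fchi : F --> chi.
  apply: spectrum_cvg => c; apply/(@cvgrPdist_lt R[i] Cx) => e e0.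
  have [k [k0 kP]] := char_separate hC (chi : character C) c e0.
  exists k; split=> // x /negP; rewrite -real_leNgt ?normr_real ?gtr0_real //.
  rewrite distrC => ex; apply: (kP (point_char x)) ex => y.
  exact: point_char_star.
(* [S] is a neighbourhood of [chi] free of points of [X], so the witness [k] vanishes at all of them
   and lies in [J]. *)
have [k [k0 kS]] : F S.
  apply: Fchi; apply: open_nbhs_nbhs; split=> //.
  by apply: closed_openC; exact: closed_closure.
exists k => //; apply/annihilator_point => x; apply: kS => /=; apply.
by apply: subset_closure; exists x.
Qed.

Lemma off_closure_char (chi : spectrum C) d : J d ->
  (chi : character C) d != 0 -> S chi.
Proof.
move=> /annihilator_point Jd d0 clchi.
have [] := clchi [set chi' : spectrum C | 0 < `|(chi' : character C) d|].
  by apply: open_nbhs_nbhs; apply: spectrum_nbhs_gt => //; rewrite normr_gt0.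
by move=> _ [[x _ <-]] /=; rewrite Jd normr0 ltxx.
Qed.

Lemma off_closure_iota (chi : spectrum C) b : S chi ->
  (chi : character C) (iota b) = 0.
Proof.
move=> Schi; apply/eqP/negPn/negP => /char_on_ideal[x chix _]; apply: Schi.
by apply: subset_closure; exists x.
Qed.

Lemma off_closure_eval (chi : spectrum C) a b d : S chi -> d = psi a + iota b ->
  (chi : character C) d = a (g chi).
Proof. by move=> Schi ->; rewrite charD off_closure_iota // addr0 gP. Qed.

(** By (NF2) the values of both characters on [J] are determined by [g]. As [chi d] is nonzero for
    some [d] in [J], the values at [c] follow from those at [c ** d]. *)
Lemma dual_inj_off_closure : {in S &, injective g}.
Proof.
move=> chi chi'; rewrite !inE => Sc Sc' gg.
have [d Jd d0] := char_off_closure Sc.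
have E e : J e -> (chi : character C) e = (chi' : character C) e.
  move=> /annihilator_decomp[a [b [_ [eE _]]]].
  by rewrite (off_closure_eval Sc eE) (off_closure_eval Sc' eE) gg.
apply: character_eq => c; apply: (mulIf d0).
rewrite {2}(E d Jd) -!charM; apply: E; exact: annihilator_mull.
Qed.

Lemma dual_homeo_on : homeo_on S g.
Proof.
split; first exact: dual_inj_off_closure.
  by apply: continuous_subspaceT; exact: dual_continuous.
move=> U oU; pose P V := open V /\ V `&` g @` S `<=` g @` (U `&` S).
exists (\bigcup_(V in P) V); first by apply: bigcup_open => V [].
apply/seteqP; split=> y; last by move=> [[V [oV VU] Vy] Sy]; exact: VU.
move=> [chi [Uchi Schi] <-]; split; last by exists chi.
have [d Jd d0] := char_off_closure Schi.
have [a [b [_ [dE _]]]] := annihilator_decomp Jd.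
pose h := `|(chi : character C) d| / 2.
have h0 : 0 < h by rewrite divr_gt0 // normr_gt0.
pose K := [set chi' : spectrum C | h <= `|(chi' : character C) d|].
have cKU : compact (K `&` ~` U).
  by apply: compact_closedI; [exact: spectrum_compact|exact: open_closedC].
have KS chi' : K chi' -> S chi'.
  by move=> Kc; apply: (off_closure_char Jd); rewrite -normr_gt0 (lt_le_trans h0).
(* On [S] the value at [d] is [a] at the image, so a point of [S] over the second set lies in [K];
   avoiding the compact image of [K] minus [U] then puts it in [U]. *)
exists (~` (g @` (K `&` ~` U)) `&` ~` [set y | `|a y| <= h]); last first.
  split.
    move=> [chi' [Kc nU] /dual_inj_off_closure E]; apply: nU.
    by rewrite E ?inE //; exact: KS.
  rewrite /= -(off_closure_eval Schi dE); apply/negP.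
  rewrite -real_ltNge ?normr_real ?gtr0_real // /h ltr_pdivrMr //.
  by rewrite ltr_pMr ?normr_gt0 // ltr1n.
split.
  apply: openI; apply: closed_openC.
    apply: compact_closed => //; apply: continuous_compact => //.
    by apply: continuous_subspaceT; exact: dual_continuous.
  by apply: closed_norm_le; exact: C0_continuous.
move=> v [[nKU /= /negP ah] [chi' Sc' vE]]; rewrite -{}vE in nKU ah *.
exists chi' => //; split=> //; apply: contrapT => nU; apply: nKU.
exists chi' => //; split=> //; rewrite /K /= (off_closure_eval Sc' dE).
by apply: ltW; rewrite real_ltNge ?normr_real ?gtr0_real.
Qed.

(** Take W = {|a| > h}. Its closure lies in the compact set {|a| >= h}, whose preimage in [X] is
    {|b'| >= h}, compact because a o f = b' is in C_0(X). *)
Lemma dual_off_closure_Prp : g @` S `<=` Prp f.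
Proof.
move=> _ [chi Schi <-]; have [d Jd d0] := char_off_closure Schi.
have [a [b [b' [dE ab']]]] := annihilator_decomp Jd.
have ag : a (g chi) != 0 by rewrite -(off_closure_eval Schi dE).
pose h := `|a (g chi)| / 2.
have h0 : 0 < h by rewrite divr_gt0 // normr_gt0.
pose W := ~` [set y | `|a y| <= h].
have clW : closure W `<=` [set y | h <= `|a y|].
  have /closure_id -> : closed [set y | h <= `|a y|].
    by apply: closed_le_norm => //; exact: C0_continuous.
  apply: closureS => y /= /negP; rewrite -real_ltNge ?normr_real ?gtr0_real //.
  exact: ltW.
exists W; last first.
  rewrite /W /=; apply/negP; rewrite -real_ltNge ?normr_real ?gtr0_real //.
  by rewrite /h ltr_pdivrMr // ltr_pMr ?normr_gt0 // ltr1n.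
split.
- by apply: closed_openC; apply: closed_norm_le; exact: C0_continuous.
- rewrite precompactE; apply: subclosed_compact clW; first exact: closed_closure.
  exact: C0_vanishing.
- apply: (subclosed_compact _ (C0_vanishing (f := b') h0)).
    apply: closed_comp; first by move=> x _; exact: cf.
    exact: closed_closure.
  by move=> x /clW /=; rewrite ab'.
Qed.

(** By properness a limit [y] in [Prp f] is the image of some [chi] in [closure S]. Outside [S],
    [chi] would be a point of [X] by [closure_over_Prp], but [X] is open and disjoint from [S]. *)
Lemma dual_image_off_closure : g @` S = closure (g @` S) `&` Prp f.
Proof.
apply/seteqP; split=> [y gSy|y [cly Py]].
  by split; [exact: subset_closure|exact: dual_off_closure_Prp].
have [W [oW pW _] Wy] := Py.
have cL : compact (g @` (closure S `&` g @^-1` closure W)).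
  apply: continuous_compact.
    by apply: continuous_subspaceT; exact: dual_continuous.
  rewrite setIC; apply: compact_closedI; last exact: closed_closure.
  by apply: dual_proper; rewrite -precompactE.
have [chi [cS cW] gy] : (g @` (closure S `&` g @^-1` closure W)) y.
  have /closure_id -> := compact_closed hY cL.
  move=> B By; have [|_ [[chi Schi <-] [Bg Wg]]] := cly (B `&` W).
    by apply: filterI => //; exact: open_nbhs_nbhs.
  exists (g chi); split => //; exists chi => //; split; exact: subset_closure.
have [//|] := pselect (S chi); first by exists chi.
move=> /contrapT clr; have [ci _ io] := point_char_inclusion.
rewrite -gy in Py.
have rchi := closure_over_Prp (@spectrum_hausdorff R C) dual_continuous ci
  dual_point clr Py.
have [|chi' [Sc' rc']] := cS (range point_char).
  by apply: open_nbhs_nbhs; split=> //; exact: io openT.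
by exfalso; apply: Sc'; exact: subset_closure.
Qed.

Lemma spectrum_compactification : fibrewise_compactification f g.
Proof.
split.
- exact: spectrum_hausdorff.
- exact: spectrum_locally_compact.
- exact: dual_continuous.
- exact: dual_proper.
exists point_char; split.
- exact: point_char_inclusion.
- by apply/funext => x; exact: dual_point.
- exact: dual_homeo_on.
- exact: dual_off_closure_Prp.
- exists (closure (g @` S)); first exact: closed_closure.
  exact: dual_image_off_closure.
Qed.

Lemma dual_range_closed : closed (range g).
Proof.
move=> y cly; have [U yU [cU clU]] := lcY (x := y) I; rewrite withinET in yU.
have cL : compact (g @` (g @^-1` U)).
  apply: continuous_compact; last exact: dual_proper.
  by apply: continuous_subspaceT; exact: dual_continuous.
suff [chi _ <-] : (g @` (g @^-1` U)) y by exists chi.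
have /closure_id -> := compact_closed hY cL.
move=> B By; have [|_ [[chi _ <-] [Bg Ug]]] := cly (B `&` U).
  exact: filterI.
by exists (g chi); split => //; exists chi.
Qed.

(* If [y] is not in the range of [g], choose [a] with [a y = 1] vanishing on
   that range. Then [psi a] lies in [J], and for injective [psi] the formula
   [c |-> a' y], where [c ** psi a = psi a' + iota b], defines a character of
   [C] lying over [y]. *)
Lemma dual_surjective : injective psi -> range g = setT.
Proof.
move=> psi_inj; apply/seteqP; split=> // y _; apply: contrapT => ny.
have [a [_ a1 ag]] := C0_bump R hY lcY (closed_openC dual_range_closed) ny.
have af x : a (f x) = 0.
  apply/eqP/negPn/negP => /ag; apply; exists (point_char x) => //.
  exact: dual_point.
have Jpa : J (psi a).
  by apply/annihilator_point => x; rewrite /point_char_fun M_psi af mul0r.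
(* The difference [psi (a1' - a2)] is in the ideal, so its product with [psi a] is in the ideal and
   in [J], hence 0; injectivity and [a y = 1] conclude. *)
have uniq a1' b1 a2 b2 : psi a1' + iota b1 = psi a2 + iota b2 -> a1' y = a2 y.
  move=> E; have E0 : psi (a1' - a2) = iota (b2 - b1).
    rewrite (star_homB hpsi) (star_homB hiota); apply/eqP.
    by rewrite subr_eq addrAC eq_sym subr_eq E addrC.
  have [b _ bE] := range_idealr iotaP (psi a) (b2 - b1).
  have : psi ((a1' - a2) ** a) = 0.
    rewrite (star_homM hpsi) E0 -bE; rewrite (iota_ann_eq0 iotaP (b := b)).
      exact: star_hom0.
    by rewrite bE; exact: annihilator_mull.
  rewrite -[X in _ = X](star_hom0 hpsi) => /psi_inj.
  move=> /(congr1 (fun h : C0 R Y => h y)).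
  rewrite [LHS](_ : _ = (a1' y - a2 y) * a y) // a1 mulr1 => /eqP.
  by rewrite subr_eq0 => /eqP.
have lex c : exists v, exists a' b, c ** psi a = psi a' + iota b /\ v = a' y.
  have [a' [b [_ [E _]]]] := annihilator_decomp (annihilator_mull c Jpa).
  by exists (a' y), a', b.
have [l lP] := choice lex.
have lE c a' b : c ** psi a = psi a' + iota b -> l c = a' y.
  by have [a'' [b'' [E ->]]] := lP c; rewrite E; exact: uniq.
have lD : {morph l : c d / c + d}.
  move=> c d; have [a' [b [E ->]]] := lP c; have [a'' [b'' [E' ->]]] := lP d.
  apply: (lE _ (a' + a'') (b + b'')).
  by rewrite amulDl E E' (star_homD hpsi) (star_homD hiota) addrACA.
have lZ k c : l (k *: c) = k * l c.
  have [a' [b [E ->]]] := lP c; apply: (lE _ (k *: a') (k *: b)).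
  by rewrite amulZl E (star_homZ hpsi) (star_homZ hiota) scalerDr.
have lpsi a' : l (psi a') = a' y.
  rewrite (lE _ (a' ** a) 0) ?(star_hom0 hiota) ?addr0 ?(star_homM hpsi) //.
  by rewrite [LHS](_ : _ = a' y * a y) // a1 mulr1.
have lM c d : l (c ** d) = l c * l d.
  have [a' [b [E ->]]] := lP c; have [a'' [b'' [E' ->]]] := lP d.
  have [b3 E3] := range_iota_mulB a' a'' b b''.
  have [a4 [b4 [E4 ->]]] := lP (c ** d).
  (* The product of [c], [d] and two factors [psi a] is decomposed in two ways; the extra factor is
     harmless since [a y = 1]. *)
  have [b5 E5] := range_iota_mulB a4 a b4 0.
  have : psi (a4 ** a) + iota b5 = psi (a' ** a'') + iota b3.
    rewrite -E3 -E5 -E -E' -E4 (star_hom0 hiota) addr0 -!amulA; congr (c ** _).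
    by rewrite hC -!amulA hC -!amulA.
  move=> /uniq; rewrite [LHS](_ : _ = a4 y * a y) // a1 mulr1 => ->.
  by [].
have l0 : exists c, l c != 0 by exists (psi a); rewrite lpsi a1 oner_eq0.
apply: ny; exists (Character lD lZ lM l0 : spectrum C) => //.
by apply: (C0_sep_inj hY lcY (R := R)) => a'; rewrite gP -lpsi.
Qed.

End dual_map.
End compactification_spectrum.

Theorem proposition3p12 (R : realType) (X Y : topologicalType)
    (hX : hausdorff_space X) (lcX : locally_compact [set: X])
    (hY : hausdorff_space Y) (lcY : locally_compact [set: Y])
    (f : X -> Y) (cf : continuous f) :
  [/\ Mor (pullback (R := R) cf),
      forall (Z : topologicalType) (g : Z -> Y)
          (fg : fibrewise_compactification f g),
        nc_fibrewise_compactification (pullback (R := R) cf)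
          (proper_pullback (R := R) (fc_continuous fg) (fc_proper fg)),
      forall (C : cstarType R) (psi : C0 R Y -> C),
        nc_fibrewise_compactification (pullback (R := R) cf) psi ->
        (forall x y : C, x ** y = y ** x) /\
        exists2 g : spectrum C -> Y,
          gelfand_dual psi g & fibrewise_compactification f g,
      forall (Z : topologicalType) (g : Z -> Y) (fg : perfection f g),
        nc_perfection (pullback (R := R) cf)
          (proper_pullback (R := R) (fc_continuous fg.1) (fc_proper fg.1))
    & forall (C : cstarType R) (psi : C0 R Y -> C),
        nc_perfection (pullback (R := R) cf) psi ->
        (forall x y : C, x ** y = y ** x) /\
        exists2 g : spectrum C -> Y, gelfand_dual psi g & perfection f g].
Proof.
split.
- exact: pullback_Mor.
- by move=> Z g fg; exact: compactification_nc.
- move=> C psi [psiP [iota [iotaP [apsi nf2]]]].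
  split; first exact: (compactification_comm hX lcX iotaP psiP nf2).
  have [g gP] := gelfand_dual_ex hY lcY psiP.
  by exists g => //; exact: (spectrum_compactification hX lcX hY lcY psiP apsi nf2).
- move=> Z g [fg gsurj]; split; first exact: compactification_nc.
  move=> a a' aa'; apply: C0_eqP => y.
  have [z _ <-] : range g y by rewrite gsurj.
  exact: (congr1 (fun h : C0 R Z => h z) aa').
- move=> C psi [[psiP [iota [iotaP [apsi nf2]]]] psi_inj].
  split; first exact: (compactification_comm hX lcX iotaP psiP nf2).
  have [g gP] := gelfand_dual_ex hY lcY psiP.
  exists g => //; split.
    exact: (spectrum_compactification hX lcX hY lcY psiP apsi nf2).
  exact: (dual_surjective hX lcX hY lcY psiP apsi nf2).
Qed.
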